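(* Let $\mathcal{H}$ be a (real or complex) Hilbert space, $n \in \mathbb{N}$, $K \subseteq \mathbb{R}^n$ closed, and let $T: B(\mathcal{H})_h \otimes \mathbb{R}[x_1, \dots, x_n] \to B(\mathcal{H})_h \otimes \mathbb{R}[x_1, \dots, x_n]$ be a real-linear operator with canonical representation \[ T = \sum_{\alpha \in \mathbb{N}_0^n} \frac{1}{\alpha!}\, Q_\alpha \times \partial^\alpha, \] where $Q_\alpha: B(\mathcal{H})_h \to B(\mathcal{H})_h \otimes \mathbb{R}[x_1, \dots, x_n]$, $\alpha \in \mathbb{N}_0^n$, are linear operators. Then the following are equivalent: (i) $T$ preserves positivity on $K$, i.e. $T\,\mathrm{Pos}(K) \subseteq \mathrm{Pos}(K)$. (ii) For every $y \in K$ and $a \in \mathcal{H}$ there exists a positive Borel map-valued measure $\mu_{y,a}: \mathrm{Bor}(K) \to \mathcal{L}(B(\mathcal{H})_h, \mathbb{R})$ such that \[ \langle [Tp(y)]a, a\rangle_{\mathcal{H}} = \int_K p(t)\, \mathrm{d}\mu_{y,a}(t) \] for all $p \in B(\mathcal{H})_h \otimes \mathbb{R}[x_1, \dots, x_n]$. (iii) For every $y \in K$ and $a \in \mathcal{H}$ there exists a positive map-valued measure $\nu_{y,a}: \mathrm{Bor}(K-y) \to \mathcal{L}(B(\mathcal{H})_h, \mathbb{R})$ such that \[ \langle Q_\alpha(A)(y)a, a\rangle_{\mathcal{H}} = \int_{K-y} t^\alpha \, \mathrm{d}\nu_{y,a}[A](t) \] for all $\alpha \in \mathbb{N}_0^n$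 and all $A \in B(\mathcal{H})_h$.
   Context: $B(\mathcal{H})_h$ denotes the real vector space of bounded self-adjoint operators on $\mathcal{H}$, and $B(\mathcal{H})_{h,+}$ the cone of positive ones ($A \succeq 0$). An operator polynomial is an element $p = \sum_{\alpha \preceq \beta} p_\alpha x^\alpha$ of $B(\mathcal{H})_h \otimes \mathbb{R}[x_1,\dots,x_n]$ with $p_\alpha \in B(\mathcal{H})_h$, viewed as the map $x \mapsto p(x) \in B(\mathcal{H})_h$ on $\mathbb{R}^n$. $\mathrm{Pos}(K) := \{p : p(x) \succeq 0 \text{ for all } x \in K\}$. $K - y := \{k - y : k \in K\}$. Canonical representation: for a linear $T$ on $B(\mathcal{H})_h \otimes \mathbb{R}[x_1,\dots,x_n]$ there are unique linear $Q_\alpha: B(\mathcal{H})_h \to B(\mathcal{H})_h\otimes\mathbb{R}[x_1,\dots,x_n]$ with $T(A \otimes x^\beta) = \sum_{\alpha} \frac{1}{\alpha!} Q_\alpha(A)\, \partial^\alpha x^\beta$ for all $A$, $\beta$; explicitly $Q_\beta(A) = \sum_{\alpha \preceq \beta} \binom{\beta}{\alpha}(-1)^{\beta-\alpha} T(A\otimes x^\alpha)\, x^{\beta-\alpha}$. A positive operator-valued measure on a measurable space $(\mathcal{X},\mathcal{A})$ with values in $B(\mathcal{K})_h$ is a map $\mu:\mathcal{A}\to B(\mathcal{K})_h$ such that $S \mapsto \langle \mu(S)x, x\rangle$ is a finite positive measure for every $x \in \mathcal{K}$; integrals $\int f\,\mathrm{d}\mu \in B(\mathcal{K})_h$ of integrable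 functions are defined weakly and are linear and positivity preserving. (For $\mathcal{K}$ one-dimensional real, $B(\mathcal{K})_h=\mathbb{R}$.) A map-valued measure is a map $\mu: \mathcal{A} \to \mathcal{L}(B(\mathcal{H})_h, B(\mathcal{K})_h)$ such that $\mu[A] := \mu(\cdot)(A)$ is an operator-valued measure for every $A \in B(\mathcal{H})_h$; it is positive if $\mu[A]$ is a positive operator-valued measure for every $A \in B(\mathcal{H})_{h,+}$. For $p = A_1 p_1 + \dots + A_m p_m$ with $A_i \in B(\mathcal{H})_h$, $p_i \in \mathbb{R}[x_1,\dots,x_n]$, one sets $\int p\,\mathrm{d}\mu := \sum_i \int p_i \,\mathrm{d}\mu[A_i]$ (independent of the representation). *)

(* Defs.v *)
From HB Require Import structures.
From mathcomp Require Import all_boot all_order all_algebra.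
From mathcomp Require Import all_classical all_reals all_analysis.
From mathcomp Require Import complex.
Set Implicit Arguments.
Unset Strict Implicit.
Unset Printing Implicit Defensive.
Import Order.TTheory GRing.Theory Num.Theory.
Import numFieldNormedType.Exports.
Local Open Scope classical_set_scope.
Local Open Scope ring_scope.

Section charge_integral.
Context d (X : measurableType d) (R : realType).

Lemma hahn_ex (nu : {charge set X -> \bar R}) :
  exists PN : set X * set X, hahn_decomposition nu PN.1 PN.2.
Proof. by have [P [N h]] := Hahn_decomposition nu; exists (P, N). Qed.

Definition hahn_pick (nu : {charge set X -> \bar R}) := cid (hahn_ex nu).

Definition cpos (nu : {charge set X -> \bar R}) := jordan_pos (projT2 (hahn_pick nu)).
Definition cneg (nu : {charge set X -> \bar R}) := jordan_neg (projT2 (hahn_pick nu)).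

Definition cintegrable (nu : {charge set X -> \bar R}) (D : set X) (f : X -> \bar R) :=
  (cpos nu).-integrable D f /\ (cneg nu).-integrable D f.

Definition cintegral (nu : {charge set X -> \bar R}) (D : set X) (f : X -> \bar R) : \bar R :=
  (\int[cpos nu]_(x in D) f x - \int[cneg nu]_(x in D) f x)%E.
End charge_integral.

Definition Rn_borel (R : realType) (n : nat) := g_sigma_algebraType (@open 'rV[R]_n).

Notation mi n := (n.-tuple nat).

Definition mi_le n (a b : mi n) := [forall i, tnth a i <= tnth b i]%N.
Definition mi_sub n (b a : mi n) : mi n := [tuple (tnth b i - tnth a i)%N | i < n].
Definition mi_abs n (a : mi n) := (\sum_(i < n) tnth a i)%N.
Definition mi_binom n (b a : mi n) := (\prod_(i < n) 'C(tnth b i, tnth a i))%N.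

Definition mono (R : realType) n (x : 'rV[R]_n) (a : mi n) : R :=
  \prod_(i < n) x ord0 i ^+ tnth a i.

(* Hilbert spaces over K (K = R, or K = C = R[i]), bounded self-adjoint *)
(* operators, operator polynomials.                                    *)
(*   conj : conjugation of K, re : real part K -> R, emb : R -> K.     *)
Section Hilbert.
Variables (R : realType) (K : numFieldType) (conj : K -> K) (re : K -> R) (emb : R -> K).
Variable (H : lmodType K) (ip : H -> H -> K).

Definition inner_product :=
  [/\ forall (c : K) (x y z : H), ip (c *: x + y) z = c * ip x z + ip y z,
      forall x y, ip y x = conj (ip x y),
      forall x, 0 <= ip x x &
      forall x, ip x x = 0 -> x = 0].

Definition nsq (x : H) : R := re (ip x x).

Definition complete_ip :=
  forall u : nat -> H,
    (forall e : R, 0 < e -> exists N, forall m k, (N <= m)%N -> (N <= k)%N -> nsq (u m - u k) < e) ->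
    exists l : H, forall e : R, 0 < e -> exists N, forall m, (N <= m)%N -> nsq (u m - l) < e.

Definition hilbert := inner_product /\ complete_ip.

Definition Bh (A : H -> H) :=
  [/\ forall (c : K) (x y : H), A (c *: x + y) = c *: A x + A y,
      exists M : R, forall x, nsq (A x) <= M * nsq x &
      forall x y, ip (A x) y = ip x (A y)].

Definition Bpos (A : H -> H) := Bh A /\ forall x, 0 <= ip (A x) x.

Definition zero_op : H -> H := fun _ => 0.
Definition add_op (A B : H -> H) : H -> H := fun v => A v + B v.
Definition rscale_op (r : R) (A : H -> H) : H -> H := fun v => emb r *: A v.

Variable n : nat.

(* operator polynomials: coefficient families alpha |-> p_alpha *)
Definition opoly_fun := mi n -> H -> H.

Definition supp (p : opoly_fun) := [set a | p a <> zero_op].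

Definition opoly (p : opoly_fun) := finite_set (supp p) /\ forall a, Bh (p a).

Definition peval (p : opoly_fun) (x : 'rV[R]_n) : H -> H :=
  fun v => \sum_(a \in supp p) emb (mono x a) *: p a v.

Definition mon (A : H -> H) (b : mi n) : opoly_fun :=
  fun g => if g == b then A else zero_op.

Definition padd (p q : opoly_fun) : opoly_fun := fun g => add_op (p g) (q g).
Definition pscale (r : R) (p : opoly_fun) : opoly_fun := fun g => rscale_op r (p g).

Definition op_linear (T : opoly_fun -> opoly_fun) :=
  [/\ forall p, opoly p -> opoly (T p),
      forall p q, opoly p -> opoly q -> T (padd p q) = padd (T p) (T q) &
      forall r p, opoly p -> T (pscale r p) = pscale r (T p)].

Definition posK (Kset : set 'rV[R]_n) (p : opoly_fun) :=
  forall x, Kset x -> Bpos (peval p x).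

Definition pmulX (p : opoly_fun) (dl : mi n) : opoly_fun :=
  fun g => if mi_le dl g then p (mi_sub g dl) else zero_op.

(* canonical representation:
   Q_beta(A) = sum_{alpha <= beta} binom(beta,alpha) (-1)^{beta-alpha} T(A x^alpha) x^{beta-alpha} *)
Definition Qcan (T : opoly_fun -> opoly_fun) (b : mi n) (A : H -> H) : opoly_fun :=
  fun g v => \sum_(a \in [set a | mi_le a b])
     emb ((-1) ^+ mi_abs (mi_sub b a) * (mi_binom b a)%:R) *: pmulX (T (mon A a)) (mi_sub b a) g v.

(* positive map-valued measures mu : Bor(R^n) -> L(B(H)_h, R), concentrated on S *)
Definition pos_map_measure (S : set 'rV[R]_n)
    (mu : (H -> H) -> {charge set Rn_borel R n -> \bar R}) :=
  [/\ (forall A B, Bh A -> Bh B -> forall E : set (Rn_borel R n), measurable E -> mu (add_op A B) E = (mu A E + mu B E)%E),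
      (forall r A, Bh A -> forall E : set (Rn_borel R n), measurable E -> mu (rscale_op r A) E = (r%:E * mu A E)%E),
      (forall A, Bpos A -> forall E : set (Rn_borel R n), measurable E -> (0 <= mu A E)%E) &
      (forall A, Bh A -> forall E : set (Rn_borel R n), measurable E -> E `<=` (~` S : set (Rn_borel R n)) -> mu A E = 0%E)].

Definition cond_i (Kset : set 'rV[R]_n) (T : opoly_fun -> opoly_fun) :=
  forall p, opoly p -> posK Kset p -> posK Kset (T p).

Definition cond_ii (Kset : set 'rV[R]_n) (T : opoly_fun -> opoly_fun) :=
  forall y, Kset y -> forall a : H,
    exists mu : (H -> H) -> {charge set Rn_borel R n -> \bar R},
      [/\ pos_map_measure Kset mu,
          (forall A al, Bh A ->
             cintegrable (mu A) Kset (fun t : Rn_borel R n => (mono t al)%:E)) &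
          (forall p, opoly p ->
             re (ip (peval (T p) y a) a) =
             \sum_(al \in supp p)
               fine (cintegral (mu (p al)) Kset (fun t : Rn_borel R n => (mono t al)%:E)))].

Definition cond_iii (Kset : set 'rV[R]_n) (T : opoly_fun -> opoly_fun) :=
  forall y, Kset y -> forall a : H,
    let Ky := [set k - y | k in Kset] in
    exists nu : (H -> H) -> {charge set Rn_borel R n -> \bar R},
      [/\ pos_map_measure Ky nu,
          (forall A al, Bh A ->
             cintegrable (nu A) Ky (fun t : Rn_borel R n => (mono t al)%:E)) &
          (forall al A, Bh A ->
             re (ip (peval (Qcan T al A) y a) a) =
             fine (cintegral (nu A) Ky (fun t : Rn_borel R n => (mono t al)%:E)))].

End Hilbert.

(* Main.v *)
Require Import Defs.
From HB Require Import structures.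
From mathcomp Require Import all_boot all_order all_algebra.
From mathcomp Require Import all_classical all_reals all_analysis.
From mathcomp Require Import measurable_realfun complex ring lra.
Set Implicit Arguments.
Unset Strict Implicit.
Unset Printing Implicit Defensive.
Import Order.TTheory GRing.Theory Num.Theory.
Import numFieldNormedType.Exports.
Local Open Scope classical_set_scope.
Local Open Scope ring_scope.

(* (i) => (ii) is an operator Haviland theorem.  An operator is seen through its
   quadratic form x |-> re <A x, x>, so that operator polynomials become real
   functions of (t, x) and Pos(K) the functions nonnegative on K x H.  By
   M. Riesz's theorem the functional p |-> re <Tp(y) a, a> extends to a positive
   functional on all functions dominated by some c (1 + |t|^2)^k |x|^2.  Restricted
   to f * A with A >= 0, it gives a finitely additive content on all subsets of
   R^n, which is regularized to a Borel measure (inner approximation by compact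
   sets, outer by open sets).  The regularization is additive in the content, so
   the measures depend linearly on A.  Polynomial moments are recovered by
   Cauchy-Schwarz, since no mass escapes to infinity.
   (ii) <=> (iii): the two moment families correspond to each other by the
   translation t |-> t - y, the relation between them being unitriangular.
   (ii) => (i): near a point u of K the integral of p is, up to a small error,
   mu[p(u)] >= 0; K is exhausted by compact sets, each covered by finitely many
   such neighbourhoods. *)

(** * M. Riesz extension *)

(** The obstacle is linearity in [A]. A moment problem may have many solutions, so measures chosen
    separately for each positive operator need not add up. The functional is therefore extended
    once, for all operators together, and everything after that choice is canonical: the regularized
    measure is given by a formula that is additive and homogeneous in the content. Quadratic forms
    make a single extension possible, because all the tensors [f * A] then live in one space of real
    functions with a pointwise order. Zorn's lemma gives the extension no continuity, so its values
    on indicators are only finitely additive. The charge of a self-adjoint [A] is read off from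
    [A = (A + c) - c], a difference of positive operators available without spectral theory; any
    other such difference gives the same charge. In the converse direction, positivity of a
    map-valued measure speaks of constant operators only, while [p] varies from point to point; this
    forces the localization and an error term proportional to mass. *)

Section riesz_extension.
Variables (R : realType) (X : Type) (D : set X).
Implicit Types (G : set ((X -> R) * R)) (f g h : X -> R).

(** A partial functional is kept as its graph, so that Zorn's lemma applies to sets ordered by
    inclusion. Single-valuedness is not demanded: for a positive graph it follows from
    [graph_le]. *)
Definition linear_graph G := G (0, 0) /\
  forall c f r g s, G (f, r) -> G (g, s) -> G (c *: f + g, c * r + s).

Definition le_on f g := forall x, D x -> f x <= g x.

Definition positive_graph G := forall f r, G (f, r) -> le_on 0 f -> 0 <= r.

(** The functions that the extension must reach. The lower bound makes the set of candidate values
    in [graph_extend] nonempty, the upper bound makes its supremum finite. *)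
Definition between_graph G h :=
  (exists f r, G (f, r) /\ le_on f h) /\ (exists f r, G (f, r) /\ le_on h f).

Lemma graph_le G f r g s : linear_graph G -> positive_graph G ->
  G (f, r) -> G (g, s) -> le_on f g -> r <= s.
Proof.
move=> [_ lin] pos Gf Gg fg.
suff: 0 <= -1 * r + s by rewrite mulN1r addrC subr_ge0.
apply: (pos _ _ (lin (-1) _ _ _ _ Gf Gg)).
by move=> x Dx; rewrite scaleN1r !fctE addrC subr_ge0 fg.
Qed.

(** The value at [h] must lie above the values of all minorants of [h] and below those of all
    majorants; the supremum [c] of the former does. *)
Lemma graph_extend G h : linear_graph G -> positive_graph G ->
  between_graph G h ->
  exists G', [/\ linear_graph G', positive_graph G', G `<=` G' &
    exists c, G' (h, c)].
Proof.
move=> lG pG [[f1 [r1 [G1 f1h]]] [f2 [r2 [G2 hf2]]]].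
have [G0 lin] := lG.
pose L := [set r | exists f, G (f, r) /\ le_on f h].
pose c := sup L.
have Lub r g s : L r -> G (g, s) -> le_on h g -> r <= s.
  move=> [f [Gf fh]] Gg hg; apply: (graph_le lG pG Gf Gg) => x Dx.
  by rewrite (le_trans (fh _ Dx)) ?hg.
have Lsup : has_sup L.
  by split; [exists r1, f1 | exists r2 => r Lr; exact: Lub Lr G2 hf2].
have scal a f r : G (f, r) -> G (a *: f, a * r).
  by move=> Gf; have := lin a _ _ _ _ Gf G0; rewrite !addr0.
exists [set fr | exists f r t, [/\ G (f, r), fr.1 = f + t *: h & fr.2 = r + t * c]].
split.
- split; first by exists 0, 0, 0; rewrite scale0r mul0r !addr0.
  move=> a f r g s [f' [r' [t [Gf /= -> ->]]]] [g' [s' [u [Gg /= -> ->]]]].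
  exists (a *: f' + g'), (a * r' + s'), (a * t + u); split; first exact: lin.
    by rewrite /= scalerDr scalerDl scalerA addrACA.
  by rewrite /= mulrDr mulrDl mulrA addrACA.
- move=> _ _ [f [r [t [Gf /= -> ->]]]] ge0.
  (* Since [f + t *: h] is nonnegative on [D], the function [- t^-1 *: f] is a majorant of [h] when
     [t < 0] and a minorant when [t > 0]; comparing its value with [c] gives the sign in either
     case. *)
  have [t0|t0|t0] := ltgtP t 0.
  + have tV : 0 < - t^-1 by rewrite oppr_gt0 invr_lt0.
    have : c <= - t^-1 * r.
      apply: ge_sup; first by exists r1, f1.
      move=> s Ls; apply: (Lub _ _ _ Ls (scal (- t^-1) _ _ Gf)) => x Dx.
      have f0 : 0 <= f x + t * h x := ge0 x Dx.
      have e : - t * (- t^-1 * f x) = f x by rewrite mulrA mulrNN divff ?mul1r// lt_eqF.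
      by rewrite -(ler_pM2l (_ : 0 < - t)) ?oppr_gt0// e; lra.
    rewrite -(ler_pM2l (_ : 0 < - t)) ?oppr_gt0//.
    by rewrite mulrA mulrNN divff ?lt_eqF// mul1r; lra.
  + have : t^-1 * - r <= c.
      apply: ub_le_sup; first by case: Lsup.
      exists (t^-1 *: - f); split.
        have := scal (- t^-1) _ _ Gf.
        by rewrite scaleNr -scalerN mulNr -mulrN.
      move=> x Dx; have f0 : 0 <= f x + t * h x := ge0 x Dx.
      by rewrite !fctE /GRing.scale/= ler_pdivrMl//; lra.
    by rewrite ler_pdivrMl//; lra.
  + rewrite t0 mul0r addr0; apply: (pG _ _ Gf) => x Dx.
    by have := ge0 x Dx; rewrite t0 scale0r addr0.
- by move=> [f r] Gf; exists f, r, 0; rewrite scale0r mul0r !addr0.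
- by exists c, 0, 0, 1; rewrite scale1r mul1r !add0r.
Qed.

Lemma positive_extension G : linear_graph G -> positive_graph G ->
  exists l : (X -> R) -> R,
    [/\ forall f r, G (f, r) -> l f = r,
        forall c f g, between_graph G f -> between_graph G g ->
          l (c *: f + g) = c * l f + l g &
        forall f, between_graph G f -> le_on 0 f -> 0 <= l f].
Proof.
move=> lG pG.
(* Joining [G] inside the condition makes the empty set admissible, as the union of the empty chain
   has to be. *)
pose P := [set A | linear_graph (G `|` A) /\ positive_graph (G `|` A)].
have [F FP totF|A [[lA pA] Amax]] := @Zorn_bigcup _ P.
  have cover u v : (G `|` \bigcup_(B in F) B) u -> (G `|` \bigcup_(B in F) B) v ->
      exists B, [/\ B = set0 \/ F B, (G `|` B) u & (G `|` B) v].
    move=> [Gu|[B FB Bu]] [Gv|[C FC Cv]].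
    - by exists set0; split; [left|left|left].
    - by exists C; split; [right|left|right].
    - by exists B; split; [right|right|left].
    - have [BC|CB] := totF _ _ FB FC.
      + by exists C; split; [right|right; apply: BC|right].
      + by exists B; split; [right|right|right; apply: CB].
  have good B : B = set0 \/ F B -> linear_graph (G `|` B) /\ positive_graph (G `|` B).
    by move=> [->|/FP//]; rewrite setU0.
  have sub B : B = set0 \/ F B -> G `|` B `<=` G `|` \bigcup_(B in F) B.
    move=> [->|FB]; first by rewrite setU0; left.
    by move=> x [Gx|Bx]; [left|right; exists B].
  split.
    split; first by left; case: lG.
    move=> c f r g s Gf Gg; have [B [FB Bf Bg]] := cover _ _ Gf Gg.
    by apply: (sub _ FB); apply: (good _ FB).1.2.
  move=> f r Gf f0; have [B [FB Bf _]] := cover _ _ Gf Gf.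
  exact: (good _ FB).2 Bf f0.
set G1 := G `|` A in lA pA *.
have GG1 : G `<=` G1 by left.
have bet h : between_graph G h -> between_graph G1 h.
  move=> [[f [r [Gf fh]]] [g [s [Gg hg]]]].
  by split; [exists f, r; split => //; left|exists g, s; split => //; left].
have total h : between_graph G h -> exists c, G1 (h, c).
  move=> /bet bh; have [G2 [l2 p2 G12 [c G2c]]] := graph_extend lA pA bh.
  exists c; apply: contrapT => nG1.
  apply: (Amax G2); last first.
    split; have -> : G `|` G2 = G2 => //; apply/setUidr; exact: subset_trans G12.
  split; first by move=> x Ax; apply: G12; right.
  by move=> G2A; apply: nG1; right; apply: G2A.
have uniq f r s : G1 (f, r) -> G1 (f, s) -> r = s.
  move=> Gr Gs; apply/eqP; rewrite eq_le.
  by rewrite (graph_le lA pA Gr Gs)// (graph_le lA pA Gs Gr).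
(* Outside the domain of the maximal graph [get] returns a default value, which is why all claims
   about [l] are restricted to [between_graph]. *)
pose l h := get [set c | G1 (h, c)].
have lP h : between_graph G h -> G1 (h, l h).
  by move=> /total [c Gc]; apply: (@getPex _ [set c | G1 (h, c)]); exists c.
have lE h c : G1 (h, c) -> l h = c.
  by move=> Gc; apply: uniq (Gc); apply: (@getPex _ [set c | G1 (h, c)]); exists c.
exists l; split.
- by move=> f r Gf; apply: lE; left.
- by move=> c f g Ef Eg; apply: lE; apply: lA.2; exact: lP.
- by move=> f Ef; apply: pA; exact: lP.
Qed.

End riesz_extension.

(** * Regularization of a content *)

Section content.
Variables (R : realType) (n : nat).
Local Notation T := 'rV[R]_n.
Implicit Types (m : set T -> R) (S U V C : set T).

Definition fin_additive m := (forall S, 0 <= m S) /\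
  forall S U, S `&` U = set0 -> m (S `|` U) = m S + m U.

(** Only compact sets enter, because an open cover of a compact set reduces to a finite one: this is
    how a merely finitely additive content yields countable subadditivity. *)
Definition inner m U : \bar R :=
  ereal_sup [set (m C)%:E | C in [set C | compact C /\ C `<=` U]].

Definition outer m S : \bar R :=
  ereal_inf [set inner m U | U in [set U | open U /\ S `<=` U]].

Section fixed_content.
Variable m : set T -> R.
Hypothesis mP : fin_additive m.

Lemma content0 : m set0 = 0.
Proof.
have := mP.2 set0 set0 (setI0 _); rewrite setU0 => h.
by apply: (addrI (m set0)); rewrite addr0.
Qed.

Lemma le_content S U : S `<=` U -> m S <= m U.
Proof.
move=> SU; rewrite -(setDUK SU) mP.2 ?lerDl ?mP.1//.
by apply/seteqP; split=> x //= -[? []].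
Qed.

Lemma contentU S U : m (S `|` U) <= m S + m U.
Proof.
have -> : S `|` U = S `|` (U `\` S).
  apply/seteqP; split=> x /=; last tauto.
  by case=> ?; have [?|?] := pselect (S x); [left|left|left|right].
rewrite mP.2 ?lerD2l; first by apply: le_content => x [].
by apply/seteqP; split=> x //= -[? []].
Qed.

Lemma inner_ge U C : compact C -> C `<=` U -> ((m C)%:E <= inner m U)%E.
Proof. by move=> cC CU; apply: ereal_sup_ubound; exists C. Qed.

Lemma inner_le U : (inner m U <= (m U)%:E)%E.
Proof.
by apply: ge_ereal_sup => _ [C [_ CU] <-]; rewrite lee_fin le_content.
Qed.

Lemma inner_ge0 U : (0 <= inner m U)%E.
Proof. by rewrite (le_trans _ (inner_ge (@compact0 _) (@sub0set _ _)))// lee_fin mP.1. Qed.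

Lemma inner_fin U : inner m U \is a fin_num.
Proof. by rewrite ge0_fin_numE ?inner_ge0// (le_lt_trans (inner_le _)) ?ltry. Qed.

Lemma le_inner U V : U `<=` V -> (inner m U <= inner m V)%E.
Proof.
move=> UV; apply: ereal_sup_le => _ [C [cC CU] <-].
by exists C => //; split => //; exact: subset_trans UV.
Qed.

Lemma outer_ge0 S : (0 <= outer m S)%E.
Proof. by apply: le_ereal_inf_tmp => _ [U _ <-]; exact: inner_ge0. Qed.

Lemma outer_le S U : open U -> S `<=` U -> (outer m S <= inner m U)%E.
Proof. by move=> oU SU; apply: ereal_inf_lbound; exists U. Qed.

Lemma outer_fin S : outer m S \is a fin_num.
Proof.
rewrite ge0_fin_numE ?outer_ge0//.
rewrite (le_lt_trans (outer_le openT (@subsetT _ _)))//.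
by rewrite (le_lt_trans (inner_le _)) ?ltry.
Qed.

Lemma outer_open U : open U -> outer m U = inner m U.
Proof.
move=> oU; apply/eqP; rewrite eq_le outer_le//=.
by apply: le_ereal_inf_tmp => _ [V [oV UV] <-]; exact: le_inner.
Qed.

Lemma le_outer : {homo outer m : S U / S `<=` U >-> (S <= U)%E}.
Proof.
move=> S U SU; apply: ereal_inf_le_tmp => _ [V [oV UV] <-].
by exists V => //; split => //; exact: subset_trans UV.
Qed.

(** Normality separates the disjoint closed sets [C \ U] and [C \ V] by open [W1] and [W2]; removing
    each of these from [C] leaves the two pieces. *)
Lemma compact_subU C U V : compact C -> open U -> open V -> C `<=` U `|` V ->
  exists C1 C2, [/\ compact C1, compact C2, C1 `<=` U, C2 `<=` V & C `<=` C1 `|` C2].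
Proof.
move=> cC oU oV CUV.
have hT : hausdorff_space T := @norm_hausdorff R T.
have clC := compact_closed hT cC.
have clD W : open W -> closed (C `\` W).
  by move=> oW; rewrite setDE; apply: closedI => //; exact: open_closedC.
have CUV0 : (C `\` U) `&` (C `\` V) = set0.
  by apply/seteqP; split => // x [[Cx nUx] [_ nVx]]; have [] := CUV _ Cx.
have nT : normal_space T := @pseudometric_normal R T.
have [W1 [W2 [oW1 oW2 CW1 CW2 W12]]] :=
  (@normal_openP R T).1 nT _ _ (clD _ oU) (clD _ oV) CUV0.
exists (C `\` W1), (C `\` W2); split.
- exact: (subclosed_compact (clD _ oW1) cC (@subDsetl _ _ _)).
- exact: (subclosed_compact (clD _ oW2) cC (@subDsetl _ _ _)).
- by move=> x [Cx nW]; apply: contrapT => nU; apply: nW; exact: CW1.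
- by move=> x [Cx nW]; apply: contrapT => nU; apply: nW; exact: CW2.
- move=> x Cx; have [W1x|nW1] := pselect (W1 x); last by left.
  right; split => // W2x; have : (W1 `&` W2) x by [].
  by rewrite W12.
Qed.

Lemma inner_bigsetU (U : nat -> set T) C k : (forall i, open (U i)) ->
  compact C -> C `<=` \big[setU/set0]_(i < k) U i ->
  ((m C)%:E <= \sum_(0 <= i < k) inner m (U i))%E.
Proof.
move=> oU; elim: k C => [|k IH] C cC.
  by rewrite big_ord0 subset0 => ->; rewrite content0 big_geq.
rewrite big_ord_recr /= => CU.
have oUk : open (\big[setU/set0]_(i < k) U i).
  by rewrite -bigcup_mkord; apply: bigcup_open => i _.
have [C1 [C2 [cC1 cC2 C1U C2U CC]]] := compact_subU cC oUk (oU k) CU.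
rewrite big_nat_recr//=.
apply: (@le_trans _ _ ((m C1)%:E + (m C2)%:E)%E).
  by rewrite -EFinD lee_fin (le_trans (le_content CC))// contentU.
by apply: leeD; [exact: IH|exact: inner_ge].
Qed.

Lemma inner_bigcup (U : nat -> set T) : (forall i, open (U i)) ->
  (inner m (\bigcup_i U i) <= \sum_(i <oo) inner m (U i))%E.
Proof.
move=> oU; apply: ge_ereal_sup => _ [C [cC CU] <-].
have := cC; rewrite compact_cover => /(_ _ setT U (fun i _ => oU i)).
move=> /(_ CU)[D' _ CD'].
pose k := (\max_(i <- finmap.enum_fset D') i).+1.
have Ck : C `<=` \big[setU/set0]_(i < k) U i.
  move=> x /CD'[i /= iD Ux]; rewrite -bigcup_mkord; exists i => //=.
  by rewrite ltnS; exact: (@leq_bigmax_seq _ _ xpredT id).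
apply: le_trans (inner_bigsetU oU cC Ck) _.
by apply: nneseries_lim_ge => i _ _; exact: inner_ge0.
Qed.

Lemma outer_sigma_subadditive : sigma_subadditive (outer m).
Proof.
move=> F; apply/lee_addgt0Pr => e e0.
have e2 i : 0 < e / (2 ^ i.+1)%:R by rewrite divr_gt0// ltr0n expn_gt0.
have /choice[U UP] i : exists U, [/\ open U, F i `<=` U &
    (inner m U <= outer m (F i) + (e / (2 ^ i.+1)%:R)%:E)%E].
  have [_ [U [oU FU] <-] /ltW lt] := lb_ereal_inf_adherent (e2 i) (outer_fin (F i)).
  by exists U.
apply: (@le_trans _ _ (inner m (\bigcup_i U i))).
  apply: outer_le; first by apply: bigcup_open => i _; case: (UP i).
  by move=> x [i _ Fx]; exists i => //; case: (UP i) => _ + _; apply.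
apply: le_trans (inner_bigcup _) _; first by move=> i; case: (UP i).
apply: le_trans (epsilon_trick xpredT _ (ltW e0)); last by move=> i; exact: outer_ge0.
by apply: lee_nneseries => [i _ _|i _]; [exact: inner_ge0|case: (UP i)].
Qed.

Lemma outer0 : outer m set0 = 0%E.
Proof.
apply/eqP; rewrite eq_le outer_ge0 andbT.
by rewrite (le_trans (outer_le open0 (@subset_refl _ _)))// (le_trans (inner_le _))// content0.
Qed.

(** Inside an open [U] take a compact [C] in [U & V], then a compact [C'] in [U \ C]. They are
    disjoint, so their contents add up to at most [inner m U]; the first approximates the part of
    [U] in [V], the second dominates the part outside as [C'] grows. *)
Lemma outer_measurable_open V : open V -> caratheodory_measurable (outer m) V.
Proof.
move=> oV.
pose mu : {outer_measure set T -> \bar R} := HB.pack (outer m)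
  (isOuterMeasure.Build R T (outer m) outer0 outer_ge0 le_outer outer_sigma_subadditive).
apply: (@le_caratheodory_measurable _ _ mu) => X /=.
apply: le_ereal_inf_tmp => _ [U [oU XU] <-].
apply: (@le_trans _ _ (outer m (U `&` V) + outer m (U `&` ~` V))%E).
  by apply: leeD; apply: le_outer; exact: setSI.
rewrite outer_open; last exact: openI.
rewrite -leeBrDr ?outer_fin//; apply: ge_ereal_sup => _ [C [cC CUV] <-].
have clC := compact_closed (@norm_hausdorff R T) cC.
rewrite leeBrDr ?outer_fin// addeC -leeBrDr//.
have oUC : open (U `\` C) by rewrite setDE; apply: openI => //; exact: closed_openC.
apply: (@le_trans _ _ (inner m (U `\` C))).
  by apply: outer_le => // x [Ux nVx]; split => // /CUV[].
apply: ge_ereal_sup => _ [C' [cC' C'UC] <-].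
rewrite leeBrDr// -EFinD addrC -mP.2.
  apply: inner_ge; first exact: compactU.
  by move=> x [/CUV[]//|/C'UC[]].
by apply/seteqP; split => // x [Cx /C'UC[]].
Qed.

(** Caratheodory's measurable sets form a sigma-algebra containing the open sets. The measure is
    [outer m] itself, on every set, so identities between outer contents carry over to measures. *)
Lemma outer_measure_borel : exists mu : {measure set (Rn_borel R n) -> \bar R},
  forall E, mu E = outer m E.
Proof.
pose mu : {outer_measure set T -> \bar R} := HB.pack (outer m)
  (isOuterMeasure.Build R T (outer m) outer0 outer_ge0 le_outer outer_sigma_subadditive).
have mS (E : set (Rn_borel R n)) : measurable E -> caratheodory_measurable mu E.
  have smc : sigma_algebra setT (caratheodory_measurable mu).
    split; first exact: caratheodory_measurable_set0.
      by move=> A mA; rewrite setTD; exact: caratheodory_measurable_setC.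
    by move=> A mA; exact: caratheodory_measurable_bigcup.
  by apply: (smallest_sub smc) => U oU; exact: outer_measurable_open.
have sadd : semi_sigma_additive (outer m : set (Rn_borel R n) -> \bar R).
  move=> F mF tF mUF.
  apply: (@caratheodory_measure_sigma_additive R T mu) => //.
    by move=> i; exact: mS.
  exact: mS.
pose nu : {measure set (Rn_borel R n) -> \bar R} := HB.pack (outer m : set (Rn_borel R n) -> \bar R)
  (isMeasure.Build _ (Rn_borel R n) R (outer m) outer0 outer_ge0 sadd).
by exists nu.
Qed.

End fixed_content.

Lemma fin_additiveD m1 m2 : fin_additive m1 -> fin_additive m2 ->
  fin_additive (fun S => m1 S + m2 S).
Proof.
move=> p1 p2; split=> [S|S U SU]; first by rewrite addr_ge0 ?p1.1 ?p2.1.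
by rewrite p1.2// p2.2// addrACA.
Qed.

Lemma fin_additiveZ (c : R) m : 0 <= c -> fin_additive m ->
  fin_additive (fun S => c * m S).
Proof.
move=> c0 p; split=> [S|S U SU]; first by rewrite mulr_ge0 ?p.1.
by rewrite p.2// mulrDr.
Qed.

(** A compact set nearly optimal for [m1] and one nearly optimal for [m2] have a compact union that
    serves both contents. *)
Lemma innerD m1 m2 U : fin_additive m1 -> fin_additive m2 ->
  inner (fun S => m1 S + m2 S) U = (inner m1 U + inner m2 U)%E.
Proof.
move=> p1 p2; have p := fin_additiveD p1 p2; apply/eqP; rewrite eq_le; apply/andP; split.
  apply: ge_ereal_sup => _ [C [cC CU] <-].
  by rewrite EFinD; apply: leeD; exact: inner_ge.
rewrite -leeBrDr ?inner_fin//; apply: ge_ereal_sup => _ [C1 [cC1 C1U] <-].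
rewrite leeBrDr ?inner_fin// addeC -leeBrDr//; apply: ge_ereal_sup => _ [C2 [cC2 C2U] <-].
rewrite leeBrDr// -EFinD addrC.
apply: (@le_trans _ _ ((m1 (C1 `|` C2) + m2 (C1 `|` C2))%:E)).
  by rewrite lee_fin lerD// le_content//.
apply: (@inner_ge (fun S => m1 S + m2 S)); first exact: compactU.
by move=> x [/C1U|/C2U].
Qed.

(** Dually to [innerD], the intersection of two open supersets serves both contents. This identity
    is what makes the final measures additive in the operator. *)
Lemma outerD m1 m2 S : fin_additive m1 -> fin_additive m2 ->
  outer (fun S => m1 S + m2 S) S = (outer m1 S + outer m2 S)%E.
Proof.
move=> p1 p2; have p := fin_additiveD p1 p2; apply/eqP; rewrite eq_le; apply/andP; split.
  rewrite -leeBlDr ?outer_fin//; apply: le_ereal_inf_tmp => _ [U1 [oU1 SU1] <-].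
  rewrite leeBlDr ?outer_fin// addeC -leeBlDr ?inner_fin//.
  apply: le_ereal_inf_tmp => _ [U2 [oU2 SU2] <-].
  rewrite leeBlDr ?inner_fin// addeC.
  apply: (@le_trans _ _ (inner (fun S => m1 S + m2 S) (U1 `&` U2))).
    by apply: outer_le; [exact: openI|rewrite subsetI].
  by rewrite innerD//; apply: leeD; apply: le_inner => // x [].
apply: le_ereal_inf_tmp => _ [U [oU SU] <-].
by rewrite innerD//; apply: leeD; exact: outer_le.
Qed.

Lemma outerZ (c : R) m S : 0 <= c -> fin_additive m ->
  outer (fun S => c * m S) S = (c%:E * outer m S)%E.
Proof.
move=> c0 p; have := c0; rewrite le_eqVlt => /orP[/eqP <-|{}c0].
  have p0 : fin_additive (fun S => 0 * m S) by exact: fin_additiveZ.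
  rewrite mul0e; apply/eqP; rewrite eq_le outer_ge0// andbT.
  rewrite (le_trans (outer_le _ openT (@subsetT _ _)))//.
  by rewrite (le_trans (inner_le p0 _))// mul0r.
(* One inequality for all positive factors suffices: applied to [c^-1] and the content [c * m] it
   yields the reverse one. *)
have half (a : R) m' : 0 < a -> fin_additive m' ->
    (a%:E * outer m' S <= outer (fun S => (a * m' S)%R) S)%E.
  move=> a0 p'; apply: le_ereal_inf_tmp => _ [U [oU SU] <-].
  apply: (@le_trans _ _ (a%:E * inner m' U)%E).
    by rewrite lee_pmul2l//; exact: outer_le.
  rewrite muleC -lee_pdivlMr//; apply: ge_ereal_sup => _ [C [cC CU] <-].
  rewrite lee_pdivlMr// muleC -EFinM.
  by apply: (@inner_ge (fun S => a * m' S)).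
apply/eqP; rewrite eq_le half// andbT.
have := half c^-1 _ _ (fin_additiveZ (ltW c0) p).
rewrite invr_gt0 => /(_ c0).
under [X in (_ <= outer X S)%E]eq_fun do rewrite mulrA mulVf ?gt_eqF// mul1r.
by rewrite muleC lee_pdivrMr// muleC.
Qed.

End content.

(** * The scalar moment problem *)

Section moment_functional.
Variables (R : realType) (n : nat).
Local Notation T := 'rV[R]_n.
Implicit Types (f g : T -> R) (S U : set T).

Lemma continuous_measurable_Rn f : continuous f ->
  measurable_fun setT (f : Rn_borel R n -> R).
Proof.
move=> cf; apply: (measurability _ (RGenOInfty.measurableE R)).
move=> _ [_ [a ->] <-]; rewrite setTI; apply: sub_sigma_algebra.
by move/continuousP : cf; apply; exact: interval_open.
Qed.

Lemma open_measurable_Rn U : open U -> measurable (U : set (Rn_borel R n)).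
Proof. exact: sub_sigma_algebra. Qed.

Lemma closed_measurable_Rn S : closed S -> measurable (S : set (Rn_borel R n)).
Proof.
move=> cS; rewrite -[S]setCK; apply: measurableC.
by apply: open_measurable_Rn; exact: closed_openC.
Qed.

(** This is [1 + |t|^2]: a polynomial that is at least 1, so that its powers increase, that
    dominates every coordinate, and whose sublevel sets are compact. *)
Definition weight (t : T) : R := 1 + \sum_(i < n) t ord0 i ^+ 2.

Lemma weight_ge1 t : 1 <= weight t.
Proof. by rewrite lerDl sumr_ge0// => i _; exact: sqr_ge0. Qed.

Lemma weight_gt0 t : 0 < weight t.
Proof. exact: lt_le_trans (weight_ge1 t). Qed.

Lemma coord_le_weight (t : T) i : `|t ord0 i| <= weight t.
Proof.
have h : t ord0 i ^+ 2 <= \sum_(j < n) t ord0 j ^+ 2.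
  by rewrite (bigD1 i)//= lerDl sumr_ge0// => j _; exact: sqr_ge0.
rewrite /weight; apply: le_trans (lerD (lexx 1) h).
by rewrite -real_normK ?num_real//; nra.
Qed.

Lemma continuous_sumR (I : Type) (r : seq I) (F : I -> T -> R) :
  (forall i, continuous (F i)) -> continuous (fun t => \sum_(i <- r) F i t).
Proof.
move=> cF; elim: r => [|i r IH].
  by rewrite (_ : (fun t => _) = cst 0); [exact: cst_continuous|apply/funext => t; rewrite big_nil].
rewrite (_ : (fun t => _) = (fun t => F i t + \sum_(j <- r) F j t)).
  by move=> t; apply: continuousD; [exact: cF|exact: IH].
by apply/funext => t; rewrite big_cons.
Qed.

Lemma continuous_prodR (I : Type) (r : seq I) (F : I -> T -> R) :
  (forall i, continuous (F i)) -> continuous (fun t => \prod_(i <- r) F i t).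
Proof.
move=> cF; elim: r => [|i r IH].
  by rewrite (_ : (fun t => _) = cst 1); [exact: cst_continuous|apply/funext => t; rewrite big_nil].
rewrite (_ : (fun t => _) = (fun t => F i t * \prod_(j <- r) F j t)).
  by move=> t; apply: continuousM; [exact: cF|exact: IH].
by apply/funext => t; rewrite big_cons.
Qed.

Lemma continuousXR f k : continuous f -> continuous (fun t => f t ^+ k).
Proof.
by move=> cf t; apply: (continuous_comp (g := fun x : R => x ^+ k));
  [exact: cf|exact: exprn_continuous].
Qed.

Lemma continuous_weight : continuous weight.
Proof.
rewrite (_ : weight = cst 1 + fun t => \sum_(i < n) t ord0 i ^+ 2)//.
move=> t; apply: continuousD; first exact: cst_continuous.
by apply: continuous_sumR => i; apply: continuousXR => u; exact: coord_continuous.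
Qed.

Lemma continuous_mono a : continuous (fun t : T => mono t a).
Proof.
by apply: continuous_prodR => i; apply: continuousXR => u; exact: coord_continuous.
Qed.

Lemma weight_le_compact (M : R) : compact [set t : T | weight t <= M].
Proof.
apply: bounded_closed_compact; last first.
  have -> : [set t : T | weight t <= M] = weight @^-1` `]-oo, M].
    by apply/seteqP; split => t; rewrite /= in_itv.

  by move/continuous_closedP : continuous_weight; apply; exact: interval_closed.
apply: (@filterS _ _ _ _ _ _ (nbhs_pinfty_ge (num_real M))).
move=> r Mr t /= tM; rewrite /Num.norm/= mx_normrE; apply: bigmax_le.
  by rewrite (le_trans _ Mr)// (le_trans _ tM)// ltW// weight_gt0.
by move=> [i j] _ /=; rewrite ord1 (le_trans (coord_le_weight t j))// (le_trans tM).
Qed.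

(** Wide enough to contain the indicators of all sets beside the monomials, yet dominated by
    polynomials, which is what the extension requires. *)
Definition poly_bounded f :=
  exists k c, 0 <= c /\ forall t, `|f t| <= c * weight t ^+ k.

Lemma poly_bounded_cst f (c : R) : (forall t, `|f t| <= c) -> poly_bounded f.
Proof.
move=> fc; exists 0%N, c; split; first exact: le_trans (fc 0).
by move=> t; rewrite expr0 mulr1.
Qed.

Lemma poly_boundedP (c : R) f g : poly_bounded f -> poly_bounded g ->
  poly_bounded (c *: f + g).
Proof.
move=> [k [a [a0 fa]]] [l [b [b0 gb]]]; exists (k + l)%N, (`|c| * a + b).
split=> [|t]; first by rewrite addr_ge0// mulr_ge0.
rewrite !fctE (le_trans (ler_normD _ _))// mulrDl lerD//.
  rewrite /GRing.scale/= normrM -mulrA ler_wpM2l// (le_trans (fa t))//.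
  by rewrite ler_wpM2l// ler_weXn2l ?weight_ge1// leq_addr.
rewrite (le_trans (gb t))//.
by rewrite ler_wpM2l// ler_weXn2l ?weight_ge1// leq_addl.
Qed.

Lemma poly_boundedZ (c : R) f : poly_bounded f -> poly_bounded (c *: f).
Proof.
by move=> pf; rewrite -[_ *: _]addr0; apply: poly_boundedP => //;
  apply: (@poly_bounded_cst _ 0) => t; rewrite normr0.
Qed.

Lemma poly_boundedD f g : poly_bounded f -> poly_bounded g -> poly_bounded (f + g).
Proof. by move=> pf pg; rewrite -[f]scale1r; exact: poly_boundedP. Qed.

Lemma poly_boundedM f g : poly_bounded f -> poly_bounded g -> poly_bounded (f * g).
Proof.
move=> [k [a [a0 fa]]] [l [b [b0 gb]]]; exists (k + l)%N, (a * b).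
split=> [|t]; first exact: mulr_ge0.
by rewrite !fctE normrM exprD mulrACA ler_pM.
Qed.

Lemma poly_bounded_weight : poly_bounded weight.
Proof.
exists 1%N, 1; split => // t.
by rewrite expr1 mul1r ger0_norm// ltW// weight_gt0.
Qed.

Lemma poly_bounded_indic S : poly_bounded \1_S.
Proof.
apply: (@poly_bounded_cst _ 1) => t; rewrite indicE.
by case: (_ \in _); rewrite ?normr1 ?normr0.
Qed.

Lemma poly_bounded_prod (I : Type) (r : seq I) (F : I -> T -> R) :
  (forall i, poly_bounded (F i)) -> poly_bounded (fun t => \prod_(i <- r) F i t).
Proof.
move=> pF; elim: r => [|i r IH].
  under [X in poly_bounded X]eq_fun do rewrite big_nil.
  by apply: (@poly_bounded_cst _ 1) => t; rewrite normr1.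
under [X in poly_bounded X]eq_fun do rewrite big_cons.
exact: poly_boundedM (pF i) IH.
Qed.

Lemma poly_bounded_mono a : poly_bounded (fun t : T => mono t a).
Proof.
apply: poly_bounded_prod => i; exists (tnth a i), 1; split => // t.
by rewrite mul1r normrX lerXn2r ?nnegrE ?coord_le_weight// ltW// weight_gt0.
Qed.

Variables (K : set T) (Phi : (T -> R) -> R).

Definition positive_functional :=
  (forall (c : R) f g, poly_bounded f -> poly_bounded g ->
    Phi (c *: f + g) = c * Phi f + Phi g) /\
  forall f, poly_bounded f -> (forall t, K t -> 0 <= f t) -> 0 <= Phi f.

Hypothesis PhiP : positive_functional.

Lemma functionalZ (c : R) f : poly_bounded f -> Phi (c *: f) = c * Phi f.
Proof.
move=> pf; have p0 := poly_boundedZ 0 pf.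
have Phi0 : Phi 0 = 0.
  by have := PhiP.1 (-1) _ _ p0 p0; rewrite scale0r scaler0 addr0 mulN1r addNr.
have := PhiP.1 c _ _ pf p0.
by rewrite scale0r !addr0 Phi0 addr0.
Qed.

Lemma functionalD f g : poly_bounded f -> poly_bounded g -> Phi (f + g) = Phi f + Phi g.
Proof. by move=> pf pg; have := PhiP.1 1 _ _ pf pg; rewrite scale1r mul1r. Qed.

Lemma le_functional f g : poly_bounded f -> poly_bounded g ->
  (forall t, K t -> f t <= g t) -> Phi f <= Phi g.
Proof.
move=> pf pg fg.
suff : 0 <= -1 * Phi f + Phi g by rewrite mulN1r addrC subr_ge0.
rewrite -PhiP.1//; apply: PhiP.2; first exact: poly_boundedP.
by move=> t Kt; rewrite scaleN1r !fctE addrC subr_ge0 fg.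
Qed.

Definition content_of S := Phi \1_S.

Lemma fin_additive_content_of : fin_additive content_of.
Proof.
split=> [S|S U SU].
  by apply: PhiP.2; [exact: poly_bounded_indic|move=> t _; rewrite indicE].
rewrite /content_of -functionalD; [|exact: poly_bounded_indic..].
congr Phi; apply/funext => t; rewrite fctE !indicE in_setU.
case: (boolP (t \in S)) => [/set_mem St|_];
  case: (boolP (t \in U)) => [/set_mem Ut|_] /=; rewrite ?addr0 ?add0r//.
by have : (S `&` U) t by []; rewrite SU.
Qed.

Lemma content_of_eq0 S : S `<=` ~` K -> content_of S = 0.
Proof.
move=> SK; apply/eqP; rewrite eq_le (fin_additive_content_of.1 S) andbT.
have <- : Phi (0 *: \1_S) = 0 by rewrite functionalZ ?mul0r//; exact: poly_bounded_indic.
apply: le_functional; [exact: poly_bounded_indic|exact/poly_boundedZ/poly_bounded_indic|].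
move=> t Kt; rewrite scale0r indicE.
by have [/set_mem/SK|] := boolP (t \in S).
Qed.

Variable mu : {measure set (Rn_borel R n) -> \bar R}.
Hypothesis muE : forall E, mu E = outer content_of E.

Let cP := fin_additive_content_of.

Lemma outer_content_off S : open (~` K) -> S `<=` ~` K -> mu S = 0%E.
Proof.
move=> oK SK; apply/eqP; rewrite eq_le measure_ge0 andbT muE.
rewrite (le_trans (outer_le _ oK SK))//.
by rewrite (le_trans (inner_le cP _))// content_of_eq0.
Qed.

(* Markov: the content of [weight > M] is at most [Phi weight / M], and
   [weight <= M] is compact, so no mass escapes to infinity. *)
Lemma outer_content_total : mu setT = (Phi (cst 1))%:E.
Proof.
have <- : content_of setT = Phi (cst 1) by rewrite /content_of indicT.
apply/eqP; rewrite eq_le muE outer_open; last exact: openT.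
rewrite inner_le//=; apply/lee_addgt0Pr => e e0.
have Pw : 0 <= Phi weight.
  by apply: PhiP.2 => [|t _]; [exact: poly_bounded_weight|rewrite ltW// weight_gt0].
(* Chosen so that [Phi weight / M <= e]; the summand 1 keeps [M] positive. *)
pose M := Phi weight / e + 1.
have M0 : 0 < M by rewrite ltr_wpDl// divr_ge0// ltW.
pose C := [set t : T | weight t <= M].
apply: (@le_trans _ _ ((content_of C)%:E + e%:E)%E); last first.
  by rewrite leeD2r//; apply: inner_ge => //; exact: weight_le_compact.
rewrite -EFinD lee_fin /content_of.
apply: (@le_trans _ _ (Phi (M^-1 *: weight + \1_C))).
  apply: le_functional; [exact: poly_bounded_indic| |].
    by apply: poly_boundedP; [exact: poly_bounded_weight|exact: poly_bounded_indic].
  move=> t _; rewrite !fctE !indicE in_setT /GRing.scale/=.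
  have [_|] := boolP (t \in C).
    by rewrite lerDr mulr_ge0 ?invr_ge0 ?ltW// weight_gt0.
  rewrite notin_setE /C/= => /negP; rewrite -ltNge => /ltW wM.
  by rewrite addr0 mulrC ler_pdivlMr// mul1r.
rewrite PhiP.1; [|exact: poly_bounded_weight|exact: poly_bounded_indic].
rewrite addrC lerD2l mulrC ler_pdivrMr//.
by rewrite /M mulrDr mulr1 mulrCA divff ?gt_eqF// mulr1 lerDl ltW.
Qed.

(** * Layer-cake approximation of a nonnegative function *)

Section layers.
Variables (f : T -> R) (e : R).
Hypotheses (f0 : forall t, 0 <= f t) (e0 : 0 < e).

(** The inequality is strict so that the layers of a continuous [f] are open, where [outer] reduces
    to [inner] and is bounded by the content. The levels start at [e], not 0, so that the layer sum
    stays below [f]. *)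
Definition layer j := [set t | e * j.+1%:R < f t].

Definition layer_sum N := \sum_(0 <= j < N) e *: (\1_(layer j) : T -> R).

Lemma layer_sum_full N t : e * N%:R < f t -> layer_sum N t = e * N%:R.
Proof.
move=> h; rewrite /layer_sum fct_sumE /= (eq_big_nat _ _ (F2 := fun=> e)).
  by rewrite sumr_const_nat subn0 mulr_natr.
move=> j /andP[_ jN]; rewrite scalrfctE indicE mem_set; first by rewrite /GRing.scale/= mulr1.
by rewrite /layer/= (le_lt_trans _ h)// ler_wpM2l// ?ler_nat// ltW.
Qed.

Lemma layer_sumS N t : layer_sum N.+1 t = layer_sum N t + e * (\1_(layer N) t : R).
Proof. by rewrite /layer_sum !fct_sumE big_nat_recr. Qed.

Lemma layer_sum_le N t : layer_sum N t <= f t.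
Proof.
elim: N => [|N IH]; first by rewrite /layer_sum big_geq.
rewrite layer_sumS indicE; have [/set_mem/= h|_] := boolP (t \in layer N).
  rewrite layer_sum_full; first by rewrite -mulrDr natr1 ltW.
  by rewrite (le_lt_trans _ h)// ler_wpM2l// ?ler_nat// ltW.
by rewrite mulr0 addr0.
Qed.

Lemma le_layer_sum N t : f t <= e * N.+1%:R -> f t <= layer_sum N t + e.
Proof.
elim: N => [|N IH].
  by rewrite /layer_sum big_geq// mulr1 add0r.
move=> h; have [|h2] := leP (f t) (e * N.+1%:R).
  move=> /IH /le_trans; apply; rewrite lerD2r layer_sumS lerDl.
  by apply: mulr_ge0; [exact: ltW|rewrite indicE].
by rewrite layer_sum_full// -{2}[e]mulr1 -mulrDr natr1.
Qed.

Lemma poly_bounded_layer_sum N : poly_bounded (layer_sum N).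
Proof.
rewrite /layer_sum; elim: N => [|N IH].
  by rewrite big_geq//; apply: (@poly_bounded_cst _ 0) => t; rewrite normr0.
by rewrite big_nat_recr//=; apply/poly_boundedD => //;
  exact/poly_boundedZ/poly_bounded_indic.
Qed.

Lemma functional_layer_sum N :
  Phi (layer_sum N) = \sum_(0 <= j < N) e * content_of (layer j).
Proof.
rewrite /layer_sum; elim: N => [|N IH].
  rewrite !big_geq// -(@scale0r _ _ (\1_set0 : T -> R)) functionalZ ?mul0r//.
  exact: poly_bounded_indic.
rewrite !big_nat_recr//= functionalD ?IH.
- by rewrite functionalZ//; exact: poly_bounded_indic.
- exact: poly_bounded_layer_sum.
- exact/poly_boundedZ/poly_bounded_indic.
Qed.

End layers.

(** The layers are open, so their measure is at most their content and every partial layer sum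
    integrates to at most [Phi f]. Equality is left to [functional_integral], as [Phi] has no
    continuity along the series. *)
Lemma integral_le_functional f : continuous f -> poly_bounded f ->
  (forall t, 0 <= f t) -> (\int[mu]_t (f t)%:E <= (Phi f)%:E)%E.
Proof.
move=> cf pf f0; apply/lee_addgt0Pr => d d0.
(* With this step the error [e] integrates to at most [d] over the total mass [Phi (cst 1)], which
   may be zero. *)
pose e : R := d / (Phi (cst 1) + 1).
have P1 : 0 <= Phi (cst 1).
  by apply: PhiP.2 => // ; apply: (@poly_bounded_cst _ 1) => t; rewrite normr1.
have e0 : 0 < e by rewrite divr_gt0// ltr_wpDl.
have oL j : open (layer f e j).
  have -> : layer f e j = f @^-1` `]e * j.+1%:R, +oo[.
    by apply/seteqP; split => t; rewrite /= in_itv/= andbT.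
  by move/continuousP : cf; apply; exact: interval_open.
have mL j : measurable (layer f e j : set (Rn_borel R n)) := open_measurable_Rn (oL j).
pose g j (t : Rn_borel R n) : \bar R := (e * \1_(layer f e j) t)%:E.
have g0 j t : (0 <= g j t)%E by rewrite lee_fin; apply: mulr_ge0; [exact: ltW|rewrite indicE].
have mg j : measurable_fun [set: Rn_borel R n] (fun t => g j t).
  by apply/measurable_EFinP/measurable_funM => //; exact: measurable_indic.
have mf : measurable_fun [set: Rn_borel R n] (fun t => (f t)%:E).
  by apply/measurable_EFinP; exact: continuous_measurable_Rn.
have mG : measurable_fun [set: Rn_borel R n] (fun t => (\sum_(0 <= j <oo) g j t)%E).
  by apply: ge0_emeasurable_sum.
apply: (@le_trans _ _ (\int[mu]_t ((\sum_(0 <= j <oo) g j t) + e%:E))%E).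
  apply: ge0_le_integral => //.
  - by move=> t _; rewrite lee_fin.
  - by apply: emeasurable_funD => //; exact: measurable_cst.
  - move=> t _.
    (* As [f] may be unbounded, the number of layers needed depends on [t]; hence the infinite
       series above. *)
    pose N := Num.bound (f t / e).
    have fN : f t <= e * N.+1%:R.
      rewrite mulrC -ler_pdivrMr//.
      have /ltW/le_trans -> // := archi_boundP (divr_ge0 (f0 t) (ltW e0)).
      by rewrite ler_nat.
    apply: (@le_trans _ _ ((layer_sum f e N t)%:E + e%:E)%E).
      by rewrite -EFinD lee_fin; exact: le_layer_sum.
    rewrite leeD2r// /layer_sum fct_sumE -sumEFin.
    exact: (@nneseries_lim_ge _ (fun j => g j t) xpredT 0%N N (fun j _ _ => g0 j t)).
rewrite ge0_integralD//; last 2 first.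
- by move=> t _; exact: nneseries_ge0.
- by move=> t _; rewrite lee_fin ltW.
rewrite integral_nneseries// integral_cst// outer_content_total.
apply: leeD; last first.
  rewrite -EFinM lee_fin /e -mulrA ler_piMr ?(ltW d0)// mulrC ler_pdivrMr ?ltr_wpDl//.
  by rewrite mul1r lerDl.
apply: lime_le; first by apply: is_cvg_nneseries => j _ _; exact: integral_ge0.
apply: nearW => N.
apply: (@le_trans _ _ (Phi (layer_sum f e N))%:E); last first.
  rewrite lee_fin; apply: le_functional => //; first exact: poly_bounded_layer_sum.
  by move=> t _; exact: layer_sum_le.
rewrite functional_layer_sum -sumEFin; apply: lee_sum => j _.
rewrite /g; under eq_integral do rewrite EFinM.
rewrite (ge0_integralZl_EFin mu measurableT _ _ (ltW e0)); last 2 first.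
- by move=> t _; rewrite lee_fin indicE.
- by apply/measurable_EFinP; exact: measurable_indic.
rewrite integral_indic// setIT [X in (_ <= X)%E]EFinM lee_pmul2l//.
by rewrite muE outer_open// inner_le.
Qed.

Lemma functional_integrable f : continuous f -> poly_bounded f ->
  mu.-integrable setT (EFin \o (f : Rn_borel R n -> R)).
Proof.
move=> cf pf; apply/integrableP; split.
  by apply/measurable_EFinP; exact: continuous_measurable_Rn.
apply: (@le_lt_trans _ _ (Phi (fun t => `|f t|))%:E); last exact: ltry.
apply: integral_le_functional => //.
  by move=> t; apply: continuous_comp; [exact: cf|exact: norm_continuous].
case: pf => k [c [c0 fc]]; exists k, c; split=> // t.
by rewrite normr_id.
Qed.

(* [defect f := Phi f - \int f] is a positive functional vanishing at 1, hence
   zero by Cauchy-Schwarz: [(f + s M)^2 / (2 M) >= 0] with [s = 1, -1]. *)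
Lemma functional_integral f : continuous f -> poly_bounded f ->
  \int[mu]_(t in setT) (f t) = Phi f.
Proof.
move=> cf pf.
pose defect g := Phi g - \int[mu]_(t in setT) (g t).
have int1 : mu.-integrable setT (EFin \o (cst 1 : Rn_borel R n -> R)).
  apply: functional_integrable; first exact: cst_continuous.
  by apply: (@poly_bounded_cst _ 1) => t; rewrite normr1.
have pb1 : poly_bounded (cst 1).
  by apply: (@poly_bounded_cst _ 1) => t; rewrite normr1.
have cf2 : continuous (f * f) by move=> t; apply: continuousM; exact: cf.
have pf2 : poly_bounded (f * f) by exact: poly_boundedM.
have if2 := functional_integrable cf2 pf2.
have intf := functional_integrable cf pf.
have defect1 : defect (cst 1) = 0.
  rewrite /defect /Rintegral -[X in fine X]/(\int[mu]_(t in setT) (cst 1%:E t))%E.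
  by rewrite integral_cst// mul1e outer_content_total subrr.
(* This is the defect of [(f + s)^2]. The term in [s ^+ 2] drops out because constants have defect
   0, so an affine function of [s] is nonnegative everywhere and its slope must vanish. *)
have quad (s : R) : 0 <= defect (f * f) + 2 * s * defect f.
  pose h := (2 * s) *: f + ((s ^+ 2) *: cst 1 + f * f) : T -> R.
  have hE : h = fun t => (f t + s) ^+ 2.
    by apply/funext => t; rewrite /h !fctE /GRing.scale/=; ring.
  have ph : poly_bounded h by do 2 apply: poly_boundedP => //.
  have ch : continuous h.
    rewrite hE; apply: continuousXR => t; apply: (continuousD (g := cst s)); first exact: cf.
    exact: cst_continuous.
  have h0 t : 0 <= h t by rewrite hE sqr_ge0.
  have := integral_le_functional ch ph h0.
  have inth := functional_integrable ch ph.
  rewrite -(fineK (integrable_fin_num _ inth))// lee_fin.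
  rewrite -[fine _]/(\int[mu]_(t in setT) (h t)).
  have -> : \int[mu]_(t in setT) (h t) = 2 * s * \int[mu]_(t in setT) (f t) +
      (s ^+ 2 * \int[mu]_(t in setT) (cst 1 t) + \int[mu]_(t in setT) ((f * f) t)).
    rewrite /h.
    have i2 : mu.-integrable setT (EFin \o (fun t : Rn_borel R n => s ^+ 2 * cst 1 t)).
      exact: (integrableZl measurableT (s ^+ 2) int1).
    have i1 : mu.-integrable setT (EFin \o (fun t : Rn_borel R n => 2 * s * f t)).
      exact: (integrableZl measurableT (2 * s) intf).
    rewrite (@RintegralD _ _ _ mu setT (fun t => 2 * s * f t)
      (fun t => s ^+ 2 * cst 1 t + (f * f) t))//; last exact: (integrableD _ i2 if2).
    by rewrite (@RintegralD _ _ _ mu setT (fun t => s ^+ 2 * cst 1 t) (f * f))// !RintegralZl.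
  rewrite /h PhiP.1//; last exact: poly_boundedP.
  rewrite PhiP.1// /defect.
  have := defect1; rewrite /defect => /eqP; rewrite subr_eq0 => /eqP ->.
  by lra.
suff : defect f = 0 by rewrite /defect => /eqP; rewrite subr_eq0 => /eqP.
apply: contrapT => /eqP d0.
(* At this [s] the affine function equals -1. *)
have := quad (- (defect (f * f) + 1) / (2 * defect f)).
rewrite (_ : 2 * _ * defect f = - (defect (f * f) + 1)); first by lra.
by field.
Qed.

End moment_functional.

(** * Charges *)

Section charge_difference.
Context d (X : measurableType d) (R : realType).
Implicit Types (nu : {charge set X -> \bar R}) (m : {measure set X -> \bar R}).

Lemma integrable_le_measure m1 m2 (D : set X) (f : X -> \bar R) :
  (forall E, measurable E -> (m1 E <= m2 E)%E) -> measurable D ->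
  measurable_fun setT f -> m2.-integrable D f -> m1.-integrable D f.
Proof.
move=> m12 mD mf /integrableP[_ foo]; apply/integrableP; split.
  exact: measurable_funTS.
apply: le_lt_trans foo; apply: ge0_le_measure_integral => //.
exact: measurableT_comp.
Qed.

Lemma jordan_pos_restrict nu P N (h : hahn_decomposition nu P N) E :
  measurable E -> jordan_pos h E = nu (E `&` P).
Proof. by move=> mE; rewrite jordan_posE cjordan_posE /crestr0 mem_set. Qed.

Lemma jordan_neg_restrict nu P N (h : hahn_decomposition nu P N) E :
  measurable E -> (jordan_neg h E = - nu (E `&` N))%E.
Proof. by move=> mE; rewrite jordan_negE cjordan_negE /crestr0 mem_set. Qed.

(** The Hahn decomposition behind [cpos] is an arbitrary choice, but the negative set of a
    nonnegative charge is null, whichever was picked. *)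
Lemma cpos_nonneg nu : (forall E, measurable E -> (0 <= nu E)%E) ->
  forall E, measurable E -> cpos nu E = nu E.
Proof.
move=> nu0 E mE; rewrite /cpos; move: (projT2 _) => h.
have [[mP _] [mN nN] PN PN0] := h.
rewrite jordan_pos_restrict// -[E in RHS]setIT -PN setIUr chargeU//.
- have -> : nu (E `&` (projT1 (hahn_pick nu)).2) = 0%E; last by rewrite adde0.
  by apply/eqP; rewrite eq_le nN ?nu0//; exact: measurableI.
- exact: measurableI.
- exact: measurableI.
- by rewrite setIACA PN0 setI0.
Qed.

Variables (nu : {charge set X -> \bar R}) (m1 m2 : {measure set X -> \bar R}).
Hypothesis m1fin : forall E, measurable E -> m1 E \is a fin_num.
Hypothesis m2fin : forall E, measurable E -> m2 E \is a fin_num.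
Hypothesis nuE : forall E, measurable E -> (nu E + m2 E = m1 E)%E.

(** Minimality of the Jordan decomposition: [cpos nu] is [nu] cut down to the positive set, and [nu]
    never exceeds [m1]. Integrability thereby passes from [m1] to [cpos nu]. *)
Lemma cpos_le_minuend E : measurable E -> (cpos nu E <= m1 E)%E.
Proof.
rewrite /cpos; move: (projT2 _) => h mE; have [[mP _] _ _ _] := h.
rewrite jordan_pos_restrict//.
have mEP := measurableI _ _ mE mP.
apply: (@le_trans _ _ (m1 (E `&` (projT1 (hahn_pick nu)).1))).
  by rewrite -nuE// leeDl.
by apply: le_measure; rewrite ?inE.
Qed.

Lemma cneg_le_subtrahend E : measurable E -> (cneg nu E <= m2 E)%E.
Proof.
rewrite /cneg; move: (projT2 _) => h mE; have [_ [mN _] _ _] := h.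
rewrite jordan_neg_restrict//.
have mEN := measurableI _ _ mE mN.
apply: (@le_trans _ _ (m2 (E `&` (projT1 (hahn_pick nu)).2))).
  by rewrite -[X in (X <= _)%E]add0e leeBlDl ?fin_num_measure// nuE.
by apply: le_measure; rewrite ?inE.
Qed.

(** Any way of writing [nu] as a difference of finite measures computes its integral, because
    [cpos nu + m2] and [cneg nu + m1] are the same measure. *)
Lemma cintegral_difference (D : set X) (f : X -> R) : measurable D ->
  measurable_fun setT f ->
  m1.-integrable D (EFin \o f) -> m2.-integrable D (EFin \o f) ->
  cintegrable nu D (EFin \o f) /\
  fine (cintegral nu D (EFin \o f)) =
    \int[m1]_(x in D) (f x) - \int[m2]_(x in D) (f x).
Proof.
move=> mD mf i1 i2.
have mEf : measurable_fun setT (EFin \o f) by exact/measurable_EFinP.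
have ip := integrable_le_measure cpos_le_minuend mD mEf i1.
have im := integrable_le_measure cneg_le_subtrahend mD mEf i2.
split; first by split.
have addE E : measurable E -> measure_add (cpos nu) m2 E = measure_add (cneg nu) m1 E.
  move=> mE.
  have -> : measure_add (cpos nu) m2 E = (cpos nu E + m2 E)%E by rewrite measure_addE.
  have -> : measure_add (cneg nu) m1 E = (cneg nu E + m1 E)%E by rewrite measure_addE.
  rewrite -nuE//.
  have := jordan_decomp (projT2 (hahn_pick nu)) mE.
  rewrite /cadd/= cscaleN1 => nuE'.
  have fp : cpos nu E \is a fin_num by exact: fin_num_measure.
  have fn : cneg nu E \is a fin_num by exact: fin_num_measure.
  have {}nuE' : nu E = (cpos nu E - cneg nu E)%E by [].
  by rewrite nuE' -(fineK fp) -(fineK fn) -(fineK (m2fin mE)) -!EFinN -!EFinD; congr EFin; lra.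
have : (\int[measure_add (cpos nu) m2]_(x in D) (EFin \o f) x =
        \int[measure_add (cneg nu) m1]_(x in D) (EFin \o f) x)%E.
  by apply: eq_measure_integral => A mA _; exact: addE.
rewrite !integral_measure_add// /cintegral /Rintegral.
have f1 := integrable_fin_num mD i1; have f2 := integrable_fin_num mD i2.
have fp := integrable_fin_num mD ip; have fm := integrable_fin_num mD im.
rewrite fineB//.
rewrite -(fineK f1) -(fineK f2) -(fineK fp) -(fineK fm) -!EFinD => -[]/=.
lra.
Qed.

End charge_difference.

(** * Self-adjoint operators and operator polynomials *)

Section scalars.
Variables (R : realType) (K : numFieldType).

(* The properties of [(conj, re, emb)] shared by the real field and the complex
   field over it. *)
Record real_structure (conj : K -> K) (re : K -> R) (emb : R -> K) : Prop := {
  embD : forall a b, emb (a + b) = emb a + emb b;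
  embM : forall a b, emb (a * b) = emb a * emb b;
  conjM : forall z w, conj (z * w) = conj z * conj w;
  conjD : forall z w, conj (z + w) = conj z + conj w;
  conj_emb : forall a, conj (emb a) = emb a;
  reD : forall z w, re (z + w) = re z + re w;
  reM : forall a z, re (emb a * z) = a * re z;
  re_conj : forall z, re (conj z) = re z;
  emb_ge0 : forall a, (0 <= emb a) = (0 <= a);
  emb_re : forall z, conj z = z -> z = emb (re z) }.

End scalars.

Section operators.
Variables (R : realType) (K : numFieldType) (conj : K -> K) (re : K -> R) (emb : R -> K).
Hypothesis rs : real_structure conj re emb.
Variables (H : lmodType K) (ip : H -> H -> K).
Hypothesis ipP : inner_product conj ip.
Implicit Types (A B : H -> H) (x y : H).

Local Notation Bh := (Bh re ip).
Local Notation Bpos := (Bpos re ip).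
Local Notation nsq := (nsq re ip).
Local Notation rscale := (rscale_op emb).

Lemma emb0 : emb 0 = 0.
Proof. by apply: (addrI (emb 0)); rewrite -(embD rs) !addr0. Qed.

Lemma re0 : re 0 = 0.
Proof. by have := reM rs 0 0; rewrite mulr0 mul0r. Qed.

Lemma ipDl x y z : ip (x + y) z = ip x z + ip y z.
Proof. by have [+ _ _ _] := ipP => /(_ 1 x y z); rewrite scale1r mul1r. Qed.

Lemma ip0l z : ip 0 z = 0.
Proof. by apply: (addrI (ip 0 z)); rewrite -ipDl !addr0. Qed.

Lemma ipZl c x z : ip (c *: x) z = c * ip x z.
Proof. by have [+ _ _ _] := ipP => /(_ c x 0 z); rewrite !addr0 ip0l addr0. Qed.

Lemma ip_conj x y : ip y x = conj (ip x y).
Proof. by have [_ + _ _] := ipP. Qed.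

Lemma ipDr x y z : ip x (y + z) = ip x y + ip x z.
Proof. by rewrite ip_conj ipDl (conjD rs) -!ip_conj. Qed.

Lemma ip_embr a x y : ip x (emb a *: y) = emb a * ip x y.
Proof. by rewrite ip_conj ipZl (conjM rs) (conj_emb rs) -ip_conj. Qed.

Lemma nsq_ge0 x : 0 <= nsq x.
Proof.
have [_ _ /(_ x) + _] := ipP; rewrite [ip x x](emb_re rs) ?(emb_ge0 rs)//.
by rewrite -ip_conj.
Qed.

Lemma re_ip_sym x y : re (ip x y) = re (ip y x).
Proof. by rewrite ip_conj (re_conj rs). Qed.

Lemma nsqD x y : nsq (x + y) = nsq x + 2 * re (ip x y) + nsq y.
Proof.
rewrite /nsq ipDl !ipDr !(reD rs) (re_ip_sym y x).
by rewrite mulr_natl mulr2n !addrA.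
Qed.

Lemma nsq_emb a x : nsq (emb a *: x) = a ^+ 2 * nsq x.
Proof. by rewrite /nsq ipZl ip_embr !(reM rs) mulrA. Qed.

(** A weak Cauchy-Schwarz inequality, read off from the squares of [x + y] and [x - y]; it needs no
    square roots and suffices for all boundedness claims. *)
Lemma re_ip_bound x y : 2 * `|re (ip x y)| <= nsq x + nsq y.
Proof.
have h1 := nsq_ge0 (x + y); rewrite nsqD in h1.
have h2 := nsq_ge0 (x + emb (-1) *: y).
rewrite nsqD nsq_emb ip_embr (reM rs) sqrrN expr1n mul1r in h2.
have -> : 2 * `|re (ip x y)| = `|2 * re (ip x y)| by rewrite normrM ger0_norm.
by rewrite ler_norml; apply/andP; split; lra.
Qed.

Definition qf A x : R := re (ip (A x) x).

Lemma qfD A B x : qf (add_op A B) x = qf A x + qf B x.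
Proof. by rewrite /qf /add_op ipDl (reD rs). Qed.

Lemma qfZ r A x : qf (rscale r A) x = r * qf A x.
Proof. by rewrite /qf /rscale_op ipZl (reM rs). Qed.

Lemma qf0 x : qf (@zero_op _ H) x = 0.
Proof. by rewrite /qf /zero_op ip0l re0. Qed.

(** Self-adjointness makes [ip (A x) x] equal to its conjugate, so no information is lost by taking
    the real part. *)
Lemma BposE A : Bh A -> Bpos A <-> forall x, 0 <= qf A x.
Proof.
move=> hA; have [_ _ sA] := hA.
have e x : ip (A x) x = emb (qf A x).
  by rewrite [LHS](emb_re rs)// -ip_conj sA.
split=> [[_ h] x|h]; first by rewrite -(emb_ge0 rs) -e.
by split => // x; rewrite e (emb_ge0 rs).
Qed.

Lemma Bh0 : Bh (@zero_op _ H).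
Proof.
split=> [c x y||x y]; rewrite /zero_op ?scaler0 ?addr0//.
- by exists 0 => x; rewrite /nsq ip0l re0 mul0r.
- by rewrite ip0l ip_conj ip0l -emb0 (conj_emb rs).
Qed.

Lemma Bh_id : Bh id.
Proof. by split=> //; exists 1 => x; rewrite mul1r. Qed.

Lemma BhD A B : Bh A -> Bh B -> Bh (add_op A B).
Proof.
move=> [lA [M MA] sA] [lB [N NB] sB]; split=> [c x y||x y]; rewrite /add_op.
- by rewrite lA lB scalerDr addrACA.
(* From [|u + v|^2 <= 2 |u|^2 + 2 |v|^2]. *)
- exists (2 * M + 2 * N) => x; rewrite nsqD.
  have := re_ip_bound (A x) (B x); have := MA x; have := NB x.
  have := ler_norm (re (ip (A x) (B x))); rewrite !mulrDl.
  by nra.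
- by rewrite ipDl ipDr sA sB.
Qed.

Lemma BhZ r A : Bh A -> Bh (rscale r A).
Proof.
move=> [lA [M MA] sA]; split=> [c x y||x y]; rewrite /rscale_op.
- by rewrite lA scalerDr !scalerA mulrC.
- exists (r ^+ 2 * M) => x; rewrite nsq_emb -mulrA; apply: ler_wpM2l; [exact: sqr_ge0|exact: MA].
- by rewrite ipZl ip_embr sA.
Qed.

Lemma qf_bound A : Bh A -> exists c, 0 <= c /\ forall x, `|qf A x| <= c * nsq x.
Proof.
move=> [_ [M MA] _]; exists (`|M| + 1); split=> [|x]; first by rewrite addr_ge0.
have := re_ip_bound (A x) x; have := MA x; have := nsq_ge0 x.
move=> n0; have := ler_wpM2r n0 (ler_norm M).
have := normr_ge0 (re (ip (A x) x)); rewrite /qf mulrDl mul1r; lra.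
Qed.

Lemma Bpos_idZ c : 0 <= c -> Bpos (rscale c id).
Proof.
move=> c0; apply/BposE; first exact: (BhZ _ Bh_id).
by move=> x; rewrite qfZ mulr_ge0// nsq_ge0.
Qed.

(** Writes every self-adjoint operator as a difference of two positive ones, using only that its
    quadratic form is bounded by a multiple of [nsq]. *)
Lemma Bpos_shift A : Bh A -> exists2 c, 0 <= c & Bpos (add_op A (rscale c id)).
Proof.
move=> hA; have [c [c0 hc]] := qf_bound hA; exists c => //.
apply/BposE; first exact: (BhD hA (BhZ _ Bh_id)).
move=> x; rewrite qfD qfZ.
have : `|qf A x| <= c * qf id x := hc x.
by rewrite ler_norml => /andP[]; lra.
Qed.

(** * Evaluation and arithmetic of operator polynomials *)

Section opoly.
Variable n : nat.
Implicit Types (p q : opoly_fun H n) (a b dl : mi n) (s : seq (mi n)).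
Local Notation zero_op := (@zero_op _ H).

Lemma supp_seq p : opoly re ip p -> exists2 s, uniq s & supp p `<=` [set` s].
Proof.
move=> [fp _]; exists (finmap.enum_fset (fset_set (supp p))); first exact: finmap.fset_uniq.
by move=> a pa /=; rewrite in_fset_set// inE.
Qed.

(** Supports change under sums and scalings; padding with vanishing terms lets several polynomials
    be summed over one common list. *)
Lemma sum_suppE (V : nmodType) (G : mi n -> (H -> H) -> V) p s :
  (forall a, G a zero_op = 0) -> uniq s -> supp p `<=` [set` s] ->
  \sum_(a \in supp p) G a (p a) = \sum_(a <- s) G a (p a).
Proof.
move=> G0 us sp; rewrite [RHS]fsbig_seq//.
apply: fsbig_widen => //.
by move=> a [_ npa] /=; have -> : p a = zero_op by exact: contrapT.
Qed.

Lemma pevalE p (x : 'rV[R]_n) v s : uniq s -> supp p `<=` [set` s] ->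
  peval emb p x v = \sum_(a <- s) emb (mono x a) *: p a v.
Proof.
move=> us sp; rewrite /peval.
apply: (@sum_suppE _ (fun a A => emb (mono x a) *: A v)) => // a.
by rewrite /zero_op scaler0.
Qed.

Lemma qf_sum (I : Type) (r : seq I) (c : I -> R) (F : I -> H -> H) x :
  qf (fun v => \sum_(i <- r) emb (c i) *: F i v) x = \sum_(i <- r) c i * qf (F i) x.
Proof.
rewrite /qf; elim: r => [|i r IH]; first by rewrite !big_nil ip0l re0.
by rewrite !big_cons ipDl (reD rs) IH ipZl (reM rs).
Qed.

Lemma qf_peval p (x : 'rV[R]_n) v s : uniq s -> supp p `<=` [set` s] ->
  qf (peval emb p x) v = \sum_(a <- s) mono x a * qf (p a) v.
Proof.
move=> us sp; rewrite -qf_sum /qf.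
by rewrite (pevalE _ _ us sp).
Qed.

Lemma Bh_sum (I : Type) (r : seq I) (c : I -> R) (F : I -> H -> H) :
  (forall i, Bh (F i)) -> Bh (fun v => \sum_(i <- r) emb (c i) *: F i v).
Proof.
move=> hF; elim: r => [|i r IH].
  rewrite (_ : (fun v => _) = zero_op); first exact: Bh0.
  by apply/funext => v; rewrite big_nil.
rewrite (_ : (fun v => _) = add_op (rscale (c i) (F i)) (fun v => \sum_(i <- r) emb (c i) *: F i v)).
  by apply: BhD => //; exact: BhZ.
by apply/funext => v; rewrite big_cons.
Qed.

Lemma Bh_peval p (x : 'rV[R]_n) : opoly re ip p -> Bh (peval emb p x).
Proof.
move=> hp; have [s us sp] := supp_seq hp.
rewrite (_ : peval emb p x = fun v => \sum_(a <- s) emb (mono x a) *: p a v).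
  by apply: Bh_sum; case: hp.
by apply/funext => v; exact: pevalE.
Qed.

Lemma opoly_mon A b : Bh A -> opoly re ip (mon A b).
Proof.
move=> hA; split=> [|a]; last by rewrite /mon; case: ifP => // _; exact: Bh0.
apply: (@sub_finite_set _ _ [set b]); last exact: finite_set1.
by move=> a; rewrite /supp /mon /=; case: eqP.
Qed.

Lemma opolyD p q : opoly re ip p -> opoly re ip q -> opoly re ip (padd p q).
Proof.
move=> [fp hp] [fq hq]; split=> [|a]; last exact: BhD.
apply: (@sub_finite_set _ _ (supp p `|` supp q)); last by rewrite finite_setU.
move=> a; rewrite /supp /= /padd => npq.
have [pa|] := pselect (p a = zero_op); last by left.
have [qa|] := pselect (q a = zero_op); last by right.
by exfalso; apply: npq; rewrite pa qa; apply/funext => v; rewrite /add_op /zero_op addr0.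
Qed.

Lemma rscale0 r : rscale r zero_op = zero_op.
Proof. by apply/funext => v; rewrite /rscale_op /zero_op scaler0. Qed.

Lemma opolyZ r p : opoly re ip p -> opoly re ip (pscale emb r p).
Proof.
move=> [fp hp]; split=> [|a]; last exact: BhZ.
apply: sub_finite_set fp => a; rewrite /supp /= /pscale => npa pa.
by apply: npa; rewrite pa rscale0.
Qed.

Lemma mi_le_refl a : mi_le a a.
Proof. exact/forallP. Qed.

Definition mi_add a b : mi n := [tuple (tnth a i + tnth b i)%N | i < n].

Lemma mi_addK a b : mi_sub (mi_add a b) b = a.
Proof. by apply: eq_from_tnth => i; rewrite !tnth_mktuple addnK. Qed.

Lemma mi_subK a b : mi_le b a -> mi_add (mi_sub a b) b = a.
Proof.
by move=> /forallP ba; apply: eq_from_tnth => i; rewrite !tnth_mktuple subnK// ba.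
Qed.

Lemma mi_le_addr a b : mi_le b (mi_add a b).
Proof. by apply/forallP => i; rewrite tnth_mktuple leq_addl. Qed.

Lemma monoD (x : 'rV[R]_n) a b : mono x (mi_add a b) = mono x a * mono x b.
Proof. by rewrite /mono -big_split; apply: eq_bigr => i _; rewrite tnth_mktuple exprD. Qed.

Lemma opoly_pmulX p dl : opoly re ip p -> opoly re ip (pmulX p dl).
Proof.
move=> [fp hp]; split=> [|a]; last by rewrite /pmulX; case: ifP => // _; exact: Bh0.
apply: (@sub_finite_set _ _ ((mi_add^~ dl) @` supp p)); last exact: finite_image.
move=> a; rewrite /supp /= /pmulX; case: ifP => // dla npa.
by exists (mi_sub a dl) => //; rewrite mi_subK.
Qed.

Lemma peval_pmulX p dl (x : 'rV[R]_n) v : opoly re ip p ->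
  peval emb (pmulX p dl) x v = emb (mono x dl) *: peval emb p x v.
Proof.
move=> hp; have [s us sp] := supp_seq hp.
rewrite (pevalE _ _ us sp) scaler_sumr.
have us' : uniq [seq mi_add a dl | a <- s].
  by rewrite map_inj_uniq// => a b ab; rewrite -(mi_addK a dl) ab mi_addK.
rewrite (pevalE _ _ us').
  rewrite big_map; apply: eq_bigr => a _.
  by rewrite /pmulX mi_le_addr mi_addK scalerA -(embM rs) monoD mulrC.
move=> a; rewrite /supp /= /pmulX; case: ifP => // dla npa.
apply/mapP; exists (mi_sub a dl); first exact: (sp _ npa).
by rewrite mi_subK.
Qed.

Lemma supp_seq2 p q : opoly re ip p -> opoly re ip q ->
  exists s, [/\ uniq s, supp p `<=` [set` s], supp q `<=` [set` s],
    supp (padd p q) `<=` [set` s] & forall r, supp (pscale emb r p) `<=` [set` s]].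
Proof.
move=> hp hq; have [s us sp] := supp_seq hp; have [t ut sq] := supp_seq hq.
exists (undup (s ++ t)); rewrite undup_uniq; split => //.
- by move=> a /sp /= a_s; rewrite mem_undup mem_cat a_s.
- by move=> a /sq /= a_t; rewrite mem_undup mem_cat a_t orbT.
- move=> a /= npq; rewrite mem_undup mem_cat.
  have [pa|/sp/= -> //] := pselect (p a = zero_op).
  have [qa|/sq/= ->] := pselect (q a = zero_op); last by rewrite orbT.
  by exfalso; apply: npq; rewrite /padd pa qa; apply/funext => v; rewrite /add_op /zero_op addr0.
- move=> r a /= npa; rewrite mem_undup mem_cat.
  have [pa|/sp/= -> //] := pselect (p a = zero_op).
  by exfalso; apply: npa; rewrite /pscale pa rscale0.
Qed.

Lemma qf_pevalD p q (x : 'rV[R]_n) v : opoly re ip p -> opoly re ip q ->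
  qf (peval emb (padd p q) x) v = qf (peval emb p x) v + qf (peval emb q x) v.
Proof.
move=> hp hq; have [s [us sp sq spq _]] := supp_seq2 hp hq.
rewrite (qf_peval _ _ us sp) (qf_peval _ _ us sq) (qf_peval _ _ us spq) -big_split.
by apply: eq_bigr => a _ /=; rewrite qfD mulrDr.
Qed.

Lemma qf_pevalZ r p (x : 'rV[R]_n) v : opoly re ip p ->
  qf (peval emb (pscale emb r p) x) v = r * qf (peval emb p x) v.
Proof.
move=> hp; have [s [us sp _ _ srp]] := supp_seq2 hp hp.
rewrite (qf_peval _ _ us sp) (qf_peval _ _ us (srp r)) mulr_sumr.
by apply: eq_bigr => a _ /=; rewrite qfZ mulrCA.
Qed.

Lemma supp_mon A b : supp (mon A b) `<=` [set` [:: b]].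
Proof. by move=> a; rewrite /supp /mon /= inE; case: eqP. Qed.

Lemma qf_peval_mon A b (x : 'rV[R]_n) v : qf (peval emb (mon A b) x) v = mono x b * qf A v.
Proof. by rewrite (qf_peval _ _ _ (@supp_mon A b))// big_seq1 /mon eqxx. Qed.

(* The scalar functions [g] for which [g * id] is an operator polynomial. *)
Definition scalar_poly (g : 'rV[R]_n -> R) := exists2 p, opoly re ip p &
  forall t v, qf (peval emb p t) v = g t * nsq v.

Lemma scalar_poly_cst (c : R) : scalar_poly (cst c).
Proof.
exists (mon (rscale c id) [tuple 0%N | i < n]).
  by apply: opoly_mon; exact: (BhZ _ Bh_id).
move=> t v; rewrite qf_peval_mon qfZ /mono big1 ?mul1r// => i _.
by rewrite tnth_mktuple expr0.
Qed.

Lemma scalar_polyD g h : scalar_poly g -> scalar_poly h -> scalar_poly (fun t => g t + h t).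
Proof.
move=> [p hp pg] [q hq qh]; exists (padd p q); first exact: opolyD.
by move=> t v; rewrite qf_pevalD// pg qh mulrDl.
Qed.

Lemma scalar_polyZ c g : scalar_poly g -> scalar_poly (fun t => c * g t).
Proof.
move=> [p hp pg]; exists (pscale emb c p); first exact: opolyZ.
by move=> t v; rewrite qf_pevalZ// pg mulrA.
Qed.

Lemma scalar_poly_coordM i g : scalar_poly g -> scalar_poly (fun t => t ord0 i * g t).
Proof.
move=> [p hp pg]; pose e : mi n := [tuple (j == i : nat) | j < n].
exists (pmulX p e); first exact: opoly_pmulX.
move=> t v; rewrite /qf peval_pmulX// ipZl (reM rs) -/(qf _ _) pg mulrA.
congr (_ * _ * _); rewrite /mono (bigD1 i)//= big1 ?mulr1.
  by rewrite tnth_mktuple eqxx expr1.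
by move=> j ji; rewrite tnth_mktuple (negbTE ji) expr0.
Qed.

Lemma scalar_poly_weightX k : scalar_poly (fun t => weight t ^+ k).
Proof.
elim: k => [|k IH].
  rewrite (_ : (fun t => _) = cst 1); first exact: scalar_poly_cst.
  by apply/funext => t; rewrite expr0.
rewrite (_ : (fun t => _) = fun t : 'rV[R]_n => weight t ^+ k +
    \sum_(i <- index_enum 'I_n) t ord0 i * (t ord0 i * weight t ^+ k)).
  apply: scalar_polyD => //; elim: (index_enum _) => [|i r IHr].
    rewrite (_ : (fun t => _) = cst 0); first exact: scalar_poly_cst.
    by apply/funext => t; rewrite big_nil.
  rewrite (_ : (fun t => _) = fun t : 'rV[R]_n => t ord0 i * (t ord0 i * weight t ^+ k) +
    \sum_(i <- r) t ord0 i * (t ord0 i * weight t ^+ k)).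
    by apply: scalar_polyD => //; do 2 apply: scalar_poly_coordM.
  by apply/funext => t; rewrite big_cons.
apply/funext => t; rewrite exprS {1}/weight mulrDl mul1r mulr_suml.
by congr (_ + _); apply: eq_bigr => i _; rewrite expr2 mulrA.
Qed.

End opoly.
End operators.

(** * Representation by map-valued measures *)

Lemma charge_of_difference d (X : measurableType d) (R : realType)
    (m1 m2 : {measure set X -> \bar R}) :
  (forall E, measurable E -> m1 E \is a fin_num) ->
  (forall E, measurable E -> m2 E \is a fin_num) ->
  exists nu : {charge set X -> \bar R},
    forall E, measurable E -> nu E = (fine (m1 E) - fine (m2 E))%:E.
Proof.
move=> f1 f2.
pose c1 : {charge set X -> \bar R} := HB.pack (m1 : set X -> \bar R)
  (isCharge.Build d X R m1 (measure0 m1) f1 (@measure_semi_sigma_additive _ _ _ m1)).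
pose c2 : {charge set X -> \bar R} := HB.pack (m2 : set X -> \bar R)
  (isCharge.Build d X R m2 (measure0 m2) f2 (@measure_semi_sigma_additive _ _ _ m2)).
exists (cadd c1 (copp c2)) => E mE.
by rewrite EFinB !fineK ?f1 ?f2.
Qed.

Section representation.
Variables (R : realType) (K : numFieldType) (conj : K -> K) (re : K -> R) (emb : R -> K).
Hypothesis rs : real_structure conj re emb.
Variables (H : lmodType K) (ip : H -> H -> K).
Hypothesis ipP : inner_product conj ip.
Variable n : nat.
Local Notation T := 'rV[R]_n.
Local Notation Bh := (Bh re ip).
Local Notation Bpos := (Bpos re ip).
Local Notation opoly := (opoly re ip).
Local Notation qf := (qf re ip).
Local Notation rscale := (rscale_op emb).
Local Notation peval := (peval emb).
Implicit Types (N : (H -> H) -> mi n -> R) (S : set T) (p q : opoly_fun H n)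
  (A B P Q : H -> H) (mu : (H -> H) -> {charge set Rn_borel R n -> \bar R}).

(** [N A a] stands for the value of a linear functional on the operator monomial [A x^a];
    [moment_sum N] is that functional on operator polynomials. *)
Definition moment_family N :=
  (forall A B a, Bh A -> Bh B -> N (add_op A B) a = N A a + N B a) /\
  (forall r A a, Bh A -> N (rscale r A) a = r * N A a).

Definition moment_sum N p := \sum_(a \in supp p) N (p a) a.

Definition moment_positive S N :=
  forall p, opoly p -> posK re emb ip S p -> 0 <= moment_sum N p.

Definition represents S mu N :=
  [/\ pos_map_measure re emb ip S mu,
      forall A al, Bh A ->
        cintegrable (mu A) S (fun t : Rn_borel R n => (mono t al)%:E) &
      forall A al, Bh A ->
        fine (cintegral (mu A) S (fun t : Rn_borel R n => (mono t al)%:E)) = N A al].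

Lemma moment_family0 N a : moment_family N -> N (@zero_op _ H) a = 0.
Proof.
move=> [_ NZ]; rewrite -(rscale0 emb H 0) NZ ?mul0r//; exact: (Bh0 rs ipP).
Qed.

Lemma moment_sumE N p s : moment_family N -> uniq s -> supp p `<=` [set` s] ->
  moment_sum N p = \sum_(a <- s) N (p a) a.
Proof.
move=> NP us sp; apply: (@sum_suppE _ _ _ _ (fun a A => N A a)) => // a.
exact: moment_family0.
Qed.

Lemma moment_sum_lin N c p q : moment_family N -> opoly p -> opoly q ->
  moment_sum N (padd (pscale emb c p) q) = c * moment_sum N p + moment_sum N q.
Proof.
move=> NP hp hq; have hcp := opolyZ rs ipP c hp.
have [s [us scp sq spq _]] := supp_seq2 emb hcp hq.
have [t [ut tp _ _ tcp]] := supp_seq2 emb hp hp.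
rewrite (moment_sumE NP us spq) (moment_sumE NP us sq).
have -> : c * moment_sum N p = moment_sum N (pscale emb c p).
  rewrite (moment_sumE NP ut tp) (moment_sumE NP ut (tcp c)) mulr_sumr.
  by apply: eq_bigr => a _; rewrite NP.2//; case: hp.
rewrite (moment_sumE NP us scp) -big_split; apply: eq_bigr => a _.
by rewrite NP.1//; [case: hcp|case: hq].
Qed.

Lemma moment_sum_mon N A al : moment_family N -> moment_sum N (mon A al) = N A al.
Proof.
move=> NP; rewrite (moment_sumE NP _ (@supp_mon _ H n A al))//.
by rewrite big_seq1 /mon eqxx.
Qed.

(** * The operator Haviland theorem *)

Section haviland.
Variables (S : set T) (N : (H -> H) -> mi n -> R).
Hypotheses (clS : closed S) (NP : moment_family N) (Npos : moment_positive S N).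

(** Different coefficient families may define the same function on [D] when [S] is small; positivity
    then forces equal moment sums, so no well-definedness has to be shown beforehand. *)
Let G : set ((T * H -> R) * R) := [set fr | exists2 p, opoly p &
  fr = (fun tx => qf (peval p tx.1) tx.2, moment_sum N p)].
Let D : set (T * H) := [set tx | S tx.1].

Let linG : linear_graph G.
Proof.
split.
  exists (mon (@zero_op _ H) [tuple 0%N | i < n]).
    by apply: (opoly_mon rs ipP); exact: (Bh0 rs ipP).
  congr pair; last by rewrite moment_sum_mon// moment_family0.
  by apply/funext => tx; rewrite (qf_peval_mon rs ipP) (qf0 rs ipP) mulr0.
move=> c _ _ _ _ [p hp [-> ->]] [q hq [-> ->]].
have hcp := opolyZ rs ipP c hp.
exists (padd (pscale emb c p) q); first exact: (opolyD rs ipP).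
congr pair; last by rewrite moment_sum_lin.
by apply/funext => tx; rewrite (qf_pevalD rs ipP)// (qf_pevalZ rs ipP).
Qed.

Let posG : positive_graph D G.
Proof.
move=> _ _ [p hp [-> ->]] p0; apply: Npos => // t St.
apply/(BposE rs ipP); first exact: (Bh_peval rs ipP).
by move=> v; exact: (p0 (t, v)).
Qed.

Let tensor (f : T -> R) A (tx : T * H) := f tx.1 * qf A tx.2.

Let between_tensor f A : poly_bounded f -> Bh A -> between_graph D G (tensor f A).
Proof.
move=> [k [c [c0 fc]]] hA; have [b [b0 Ab]] := qf_bound rs ipP hA.
have [p hp pE] := scalar_polyZ rs ipP (c * b) (scalar_poly_weightX rs ipP n k).
have bound t x : `|tensor f A (t, x)| <= qf (peval p t) x.
  rewrite pE normrM (_ : _ * _ * _ = (c * weight t ^+ k) * (b * nsq re ip x)); last by ring.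
  by apply: ler_pM => //.
split.
  exists (fun tx => qf (peval (pscale emb (-1) p) tx.1) tx.2), (moment_sum N (pscale emb (-1) p)).
  split; first by exists (pscale emb (-1) p) => //; exact: (opolyZ rs ipP).
  move=> [t x] _; rewrite (qf_pevalZ rs ipP)// mulN1r lerNl.
  by have := bound t x; rewrite ler_norml => /andP[]; rewrite lerNl.
exists (fun tx => qf (peval p tx.1) tx.2), (moment_sum N p).
split; first by exists p.
by move=> [t x] _; have := bound t x; rewrite ler_norml => /andP[].
Qed.

Lemma haviland : exists mu, represents S mu N.
Proof.
have [l [lG llin lpos]] := positive_extension linG posG.
have l0 : l 0 = 0 by apply: lG; exact: linG.1.
pose Phi A f := l (tensor f A).
have PhiP A : Bpos A -> positive_functional S (Phi A).
  move=> pA; have hA := pA.1; split=> [c f g pf pg|f pf f0].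
    rewrite /Phi -llin; [|exact: between_tensor..].
    congr l; apply/funext => tx; rewrite /tensor !fctE /GRing.scale/=; ring.
  apply: lpos; first exact: between_tensor.
  move=> [t x] Dtx; apply: mulr_ge0; first exact: f0.
  by move/(BposE rs ipP hA) : pA; apply.
(* The functional [l] sees operators only through their quadratic forms, so the hypothesis compares
   forms instead of operators; the same pattern recurs below. *)
have PhiD A B C f : Bh A -> Bh B -> Bh C -> poly_bounded f ->
    (forall x, qf C x = qf A x + qf B x) -> Phi C f = Phi A f + Phi B f.
  move=> hA hB hC pf CE; rewrite -[X in X + _]mul1r /Phi -llin; [|exact: between_tensor..].
  by congr l; apply/funext => tx; rewrite /tensor CE !fctE /GRing.scale/=; ring.
have PhiZ A B r f : Bh A -> Bh B -> poly_bounded f ->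
    (forall x, qf B x = r * qf A x) -> Phi B f = r * Phi A f.
  move=> hA hB pf BE; rewrite /Phi.
  have b0 : between_graph D G 0 by split; exists 0, 0; split => //; exact: linG.1.
  have := llin r _ _ (between_tensor pf hA) b0; rewrite l0 !addr0 => <-.
  by congr l; apply/funext => tx; rewrite /tensor BE !fctE /GRing.scale/=; ring.
pose m A := content_of (Phi A).
have mP A (pA : Bpos A) : fin_additive (m A) := fin_additive_content_of (PhiP A pA).
pose o A E : R := fine (outer (m A) E).
have oK A E : Bpos A -> outer (m A) E = (o A E)%:E.
  by move=> pA; rewrite fineK// outer_fin//; exact: mP.
have oD A B C E : Bpos A -> Bpos B -> Bpos C ->
    (forall x, qf C x = qf A x + qf B x) -> o C E = o A E + o B E.
  move=> pA pB pC CE; apply: EFin_inj; rewrite EFinD -!oK// -outerD; [|exact: mP..].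
  congr outer; apply/funext => U; apply: PhiD => //; [exact: pA.1|exact: pB.1|exact: pC.1|].
  exact: poly_bounded_indic.
have oZ A B r E : 0 <= r -> Bpos A -> Bpos B ->
    (forall x, qf B x = r * qf A x) -> o B E = r * o A E.
  move=> r0 pA pB BE; apply: EFin_inj; rewrite EFinM -!oK// -outerZ//; last exact: mP.
  congr outer; apply/funext => U; apply: PhiZ => //; [exact: pA.1|exact: pB.1|].
  exact: poly_bounded_indic.
(* Hence [o P E - o Q E] depends only on the difference of the forms of [P] and [Q]. *)
have oE A B C C' E : Bpos A -> Bpos B -> Bpos C -> Bpos C' ->
    (forall x, qf A x + qf B x = qf C x + qf C' x) -> o A E + o B E = o C E + o C' E.
  move=> pA pB pC pC' ABC.
  have pAB : Bpos (add_op A B).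
    apply/(BposE rs ipP); first by apply: (BhD rs ipP); [exact: pA.1|exact: pB.1].
    move=> x; rewrite (qfD rs ipP) addr_ge0//.
      by move/(BposE rs ipP pA.1) : pA; apply.
    by move/(BposE rs ipP pB.1) : pB; apply.
  rewrite -(oD A B (add_op A B))//; last exact: (qfD rs ipP).
  by apply: oD => // x; rewrite (qfD rs ipP).
have muex A : exists mu : {measure set (Rn_borel R n) -> \bar R},
    Bpos A -> forall E, mu E = outer (m A) E.
  have [pA|npA] := pselect (Bpos A); last by exists mzero.
  by have [mu muE] := outer_measure_borel (mP A pA); exists mu.
have [M ME] := choice muex.
have Mfin A E : Bpos A -> M A E \is a fin_num by move=> pA; rewrite ME// oK.
(* The charge is described on all decompositions [A = P - Q] into positive operators at once, so
   that each later identity may use the decomposition that suits it. *)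
have nuex A : exists nu : {charge set (Rn_borel R n) -> \bar R}, Bh A ->
    forall P Q, Bpos P -> Bpos Q -> (forall x, qf A x + qf Q x = qf P x) ->
    forall E, measurable E -> nu E = (o P E - o Q E)%:E.
  have [hA|nhA] := pselect (Bh A); last by exists czero.
  have [c c0 pAc] := Bpos_shift rs ipP hA; have pc := Bpos_idZ rs ipP c0.
  have [nu nuE] := charge_of_difference (fun E _ => Mfin _ E pAc) (fun E _ => Mfin _ E pc).
  exists nu => _ P Q pP pQ AQP E mE; rewrite nuE// !ME//; congr EFin.
  have := oE _ _ _ _ E pAc pQ pP pc; rewrite -!/(o _ _).
  move=> h; suff : o (add_op A (rscale c id)) E + o Q E = o P E + o (rscale c id) E by lra.
  by apply: h => x; rewrite (qfD rs ipP) -AQP; ring.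
have [nu nuE] := choice nuex.
have p0 : Bpos (@zero_op _ H).
  by apply/(BposE rs ipP); [exact: (Bh0 rs ipP)|move=> x; rewrite (qf0 rs ipP)].
have o0 E : o (@zero_op _ H) E = 0.
  apply: (addrI (o (@zero_op _ H) E)); rewrite addr0 -(oD _ _ _ E p0 p0 p0)// => x.
  by rewrite (qf0 rs ipP) addr0.
have mS : measurable (S : set (Rn_borel R n)) := closed_measurable_Rn clS.
(* The functional is an integral over the whole space; restricting it to [S] is harmless because the
   open complement of [S] is a null set. *)
have intS P f : Bpos P -> continuous f -> poly_bounded f ->
    (M P).-integrable S (EFin \o (f : Rn_borel R n -> R)) /\
    \int[M P]_(t in S) (f t) = Phi P f.
  move=> pP cf pf.
  have if_ := functional_integrable (PhiP P pP) (ME P pP) cf pf.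
  split; first exact: integrableS if_.
  rewrite -(functional_integral (PhiP P pP) (ME P pP) cf pf) /Rintegral; congr fine.
  rewrite [RHS](negligible_integral (measurableC mS) measurableT if_).
    by rewrite setTD setCK.
  exact: (outer_content_off (PhiP P pP) (ME P pP) (closed_openC clS)).
have key A al : Bh A -> cintegrable (nu A) S (fun t : Rn_borel R n => (mono t al)%:E) /\
    fine (cintegral (nu A) S (fun t : Rn_borel R n => (mono t al)%:E)) = N A al.
  move=> hA; have [a a0 pA] := Bpos_shift rs ipP hA; have pa := Bpos_idZ rs ipP a0.
  have [iA IA] := intS _ _ pA (@continuous_mono R n al) (@poly_bounded_mono R n al).
  have [ia Ia] := intS _ _ pa (@continuous_mono R n al) (@poly_bounded_mono R n al).
  have mmono := continuous_measurable_Rn (@continuous_mono R n al).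
  have [|ci ciE] := cintegral_difference (nu := nu A) (fun E _ => Mfin _ E pa) _ mS mmono iA ia.
    move=> E mE; rewrite (nuE _ hA _ _ pA pa)//; last by move=> x; rewrite [RHS](qfD rs ipP).
    by rewrite !ME// !oK// -EFinD subrK.
  split=> //; rewrite ciE IA Ia.
  rewrite (PhiD A (rscale a id) _ _ hA pa.1 pA.1 (@poly_bounded_mono R n al)); last first.
    by move=> x; rewrite (qfD rs ipP).
  rewrite addrK; apply: lG; exists (mon A al); first exact: (opoly_mon rs ipP).
  rewrite moment_sum_mon//; congr pair; apply/funext => tx.
  by rewrite (qf_peval_mon rs ipP).
exists nu; split; last 2 first.
- by move=> A al hA; exact: (key A al hA).1.
- by move=> A al hA; exact: (key A al hA).2.
- split.
  + move=> A B hA hB E mE; have hAB := BhD rs ipP hA hB.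
    have [a a0 pA] := Bpos_shift rs ipP hA; have [b b0 pB] := Bpos_shift rs ipP hB.
    have pa := Bpos_idZ rs ipP a0; have pb := Bpos_idZ rs ipP b0.
    have ab0 : 0 <= a + b by rewrite addr_ge0.
    have pab := Bpos_idZ rs ipP ab0.
    have qab x : qf (rscale (a + b) id) x = qf (rscale a id) x + qf (rscale b id) x.
      by rewrite !(qfZ rs ipP) mulrDl.
    have pABab : Bpos (add_op (add_op A B) (rscale (a + b) id)).
      apply/(BposE rs ipP); first by apply: (BhD rs ipP) => //; exact: pab.1.
      move=> x; rewrite !(qfD rs ipP) qab addrACA addr_ge0// -(qfD rs ipP).
        by move/(BposE rs ipP pA.1) : pA; apply.
      by move/(BposE rs ipP pB.1) : pB; apply.
    rewrite (nuE _ hAB _ _ pABab pab)//; last by move=> x; rewrite [RHS](qfD rs ipP).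
    rewrite (nuE _ hA _ _ pA pa)//; last by move=> x; rewrite [RHS](qfD rs ipP).
    rewrite (nuE _ hB _ _ pB pb)//; last by move=> x; rewrite [RHS](qfD rs ipP).
    rewrite -EFinD; congr EFin.
    rewrite (oD _ _ _ E pA pB pABab); last by move=> x; rewrite !(qfD rs ipP) qab; ring.
    by rewrite (oD _ _ _ E pa pb pab qab); ring.
  + move=> r A hA E mE; have hrA := BhZ rs ipP r hA.
    have [a a0 pA] := Bpos_shift rs ipP hA; have pa := Bpos_idZ rs ipP a0.
    rewrite (nuE _ hA _ _ pA pa)//; last by move=> x; rewrite [RHS](qfD rs ipP).
    have scal s B : 0 <= s -> Bpos B -> Bpos (rscale s B).
      move=> s0 pB; apply/(BposE rs ipP); first exact: (BhZ rs ipP _ pB.1).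
      by move=> x; rewrite (qfZ rs ipP) mulr_ge0//; move/(BposE rs ipP pB.1) : pB; apply.
    have qA x : qf A x = qf (add_op A (rscale a id)) x - qf (rscale a id) x.
      by rewrite (qfD rs ipP); ring.
    rewrite -EFinM; have [r0|r0] := leP 0 r.
      rewrite (nuE _ hrA _ _ (scal _ _ r0 pA) (scal _ _ r0 pa))//; last first.
        by move=> x; rewrite !(qfZ rs ipP r) qA; ring.
      rewrite (oZ _ _ _ E r0 pA (scal _ _ r0 pA))//; last exact: (qfZ rs ipP).
      rewrite (oZ _ _ _ E r0 pa (scal _ _ r0 pa))//; last exact: (qfZ rs ipP).
      by congr EFin; ring.
    (* For negative [r] the two parts change roles: [r (P - Q) = (- r) Q - (- r) P]. *)
    have Nr0 : 0 <= - r by rewrite oppr_ge0 ltW.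
    rewrite (nuE _ hrA _ _ (scal _ _ Nr0 pa) (scal _ _ Nr0 pA))//; last first.
      by move=> x; rewrite !(qfZ rs ipP r) !(qfZ rs ipP (- r)) qA; ring.
    rewrite (oZ _ _ _ E Nr0 pA (scal _ _ Nr0 pA))//; last exact: (qfZ rs ipP).
    rewrite (oZ _ _ _ E Nr0 pa (scal _ _ Nr0 pa))//; last exact: (qfZ rs ipP).
    by congr EFin; ring.
  + move=> A pA E mE; rewrite (nuE _ pA.1 _ _ pA p0)//; last first.
      by move=> x; rewrite (qf0 rs ipP) addr0.
    by rewrite o0 subr0 -oK// outer_ge0//; exact: mP.
  + move=> A hA E mE ES.
    have [a a0 pA] := Bpos_shift rs ipP hA; have pa := Bpos_idZ rs ipP a0.
    rewrite (nuE _ hA _ _ pA pa)//; last by move=> x; rewrite [RHS](qfD rs ipP).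
    have off B : Bpos B -> o B E = 0.
      move=> pB; apply: EFin_inj; rewrite -oK// -ME//.
      exact: (outer_content_off (PhiP B pB) (ME B pB) (closed_openC clS) ES).
    by rewrite !off// subrr.
Qed.

End haviland.
End representation.

(** * Translation of moments *)

Section multi_index.
Variables (R : realType) (n : nat).
Implicit Types (al b : mi n) (x z : 'rV[R]_n).

(** The common bound [mi_abs al] on all entries makes the candidates functions into a single ordinal
    type, the form in which a product of sums is expanded in [mono_add]. *)
Definition mi_below al : seq (mi n) :=
  [seq b <- map (fun phi : {ffun 'I_n -> 'I_(mi_abs al).+1} =>
     [tuple (phi i : nat) | i < n]) (enum {: {ffun 'I_n -> 'I_(mi_abs al).+1}}) | mi_le b al].

Lemma mi_le_abs b al i : mi_le b al -> (tnth b i <= mi_abs al)%N.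
Proof.
move=> /forallP/(_ i) /leq_trans; apply.
by rewrite /mi_abs (bigD1 i)//= leq_addr.
Qed.

Lemma mi_below_uniq al : uniq (mi_below al).
Proof.
apply: filter_uniq; rewrite map_inj_uniq ?enum_uniq// => f g /(congr1 (fun t => tnth t)) fg.
apply/ffunP => i; apply: val_inj.
by have := congr1 (@^~ i) fg; rewrite !tnth_mktuple.
Qed.

Lemma mem_mi_below al b : (b \in mi_below al) = mi_le b al.
Proof.
rewrite mem_filter; have [ba|//] := boolP (mi_le b al); rewrite andTb.
apply/mapP; exists [ffun i => inord (tnth b i)]; first by rewrite mem_enum.
apply: eq_from_tnth => i; rewrite tnth_mktuple ffunE inordK// ltnS.
exact: mi_le_abs.
Qed.

Lemma mi_belowE al : [set` mi_below al] = [set b | mi_le b al].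
Proof. by apply/seteqP; split => b; rewrite /= mem_mi_below. Qed.

Lemma mono_add x z al : mono (x + z) al =
  \sum_(b <- mi_below al) (mi_binom al b)%:R * mono z (mi_sub al b) * mono x b.
Proof.
(* Each binomial sum is prolonged to the common range up to [mi_abs al]; the added coefficients
   vanish, and so do the terms with [phi] not below [al] after distributing. *)
have -> : mono (x + z) al = \prod_(i < n) \sum_(j < (mi_abs al).+1)
    'C(tnth al i, j)%:R * z ord0 i ^+ (tnth al i - j) * x ord0 i ^+ j.
  apply: eq_bigr => i _; rewrite mxE addrC exprDn.
  have le : ((tnth al i).+1 <= (mi_abs al).+1)%N by rewrite ltnS mi_le_abs// mi_le_refl.
  rewrite (big_ord_widen _
    (fun j => z ord0 i ^+ (tnth al i - j) * x ord0 i ^+ j *+ 'C(tnth al i, j)) le).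
  rewrite big_mkcond; apply: eq_bigr => j _; case: ifPn => [_|].
    by rewrite -mulrA mulr_natl.
  by rewrite -leqNgt => lt; rewrite bin_small// !mul0r.
rewrite bigA_distr_bigA /= big_filter big_map [RHS]big_mkcond [RHS]big_enum /=.
apply: eq_bigr => phi _; set b := [tuple _ | i < n].
have be i : tnth b i = phi i by rewrite tnth_mktuple.
have e : \prod_(i < n) ('C(tnth al i, phi i)%:R * z ord0 i ^+ (tnth al i - phi i) *
    x ord0 i ^+ phi i) = (mi_binom al b)%:R * mono z (mi_sub al b) * mono x b.
  rewrite /mi_binom /mono natr_prod -!big_split /=; apply: eq_bigr => i _.
  by rewrite !tnth_mktuple.
case: ifPn => [_|nle]; first exact: e.
rewrite e /mi_binom; have /forallPn[i nlei] : ~~ mi_le b al by []; move: nlei; rewrite -ltnNge => lt.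
by rewrite (bigD1 i)//= bin_small// mul0n !mul0r.
Qed.

Lemma mono_opp z al : mono (- z) al = (-1) ^+ mi_abs al * mono z al.
Proof.
rewrite /mono /mi_abs -prodrXr -big_split; apply: eq_bigr => i _.
by rewrite /= mxE [LHS]exprNn.
Qed.

(* If [N b] are the moments of a measure, these are the moments of its translate
   by [z]. *)
Definition shift_moments z (N : mi n -> R) al : R :=
  \sum_(b <- mi_below al) (mi_binom al b)%:R * mono z (mi_sub al b) * N b.

Lemma shift_moments_inj z N M : shift_moments z N =1 shift_moments z M -> N =1 M.
Proof.
move=> NM al; have [k] := ubnP (mi_abs al); elim: k al => // k IH al alk.
have alal : al \in mi_below al by rewrite mem_mi_below mi_le_refl.
(* The term [b = al] has coefficient 1 and every other [b] has smaller [mi_abs], so strong induction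
   recovers the family from its translate. *)
have top L : shift_moments z L al = L al + \sum_(b <- mi_below al | b != al)
    (mi_binom al b)%:R * mono z (mi_sub al b) * L b.
  rewrite /shift_moments (bigD1_seq al) ?mi_below_uniq//=; congr (_ + _).
  rewrite /mi_binom big1 => [|i _]; last by rewrite binn.
  by rewrite /mono big1 ?mul1r// => i _; rewrite tnth_mktuple subnn expr0.
have := NM al; rewrite !top => h.
suff e : \sum_(b <- mi_below al | b != al) (mi_binom al b)%:R * mono z (mi_sub al b) * N b =
    \sum_(b <- mi_below al | b != al) (mi_binom al b)%:R * mono z (mi_sub al b) * M b.
  by apply: (addIr _ (_ : _ = _)); rewrite e in h; exact: h.
rewrite big_seq_cond [RHS]big_seq_cond; apply: eq_bigr => b /andP[].
rewrite mem_mi_below => /forallP ba bal; congr (_ * _); apply: IH.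
apply: (@leq_trans (mi_abs al)); last by rewrite -ltnS.
rewrite /mi_abs.
have [i lt] : exists i, (tnth b i < tnth al i)%N.
  apply/existsP; rewrite -[X in is_true X]negbK negb_exists; apply: contra bal.
  move=> /forallP nlt; apply/eqP/eq_from_tnth => i.
  by apply/eqP; rewrite eqn_leq ba leqNgt nlt.
rewrite (bigD1 i)//= [in X in (_ < X)%N](bigD1 i)//=.
by rewrite -addSn leq_add// leq_sum.
Qed.

End multi_index.

(** * Image measures and image charges *)

Section pushforward_measure.
Context d1 d2 (X : measurableType d1) (Y : measurableType d2) (R : realType).

Lemma pushforward_measure (f : X -> Y) (m : {measure set X -> \bar R}) :
  measurable_fun setT f ->
  exists p : {measure set Y -> \bar R}, (forall E, p E = m (f @^-1` E)) /\
    forall D (g : Y -> \bar R), measurable D -> measurable_fun setT g ->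
      m.-integrable (f @^-1` D) (g \o f) ->
      p.-integrable D g /\
      (\int[p]_(y in D) g y = \int[m]_(x in f @^-1` D) (g \o f) x)%E.
Proof.
move=> mf; exists (measure_function_pushforward__canonical__measure_function_Measure m mf).
split; last first.
  move=> D g mD mg ig; split; last exact: (integral_pushforward mf mg ig mD).
  exact: (integrable_pushforward mf mg ig mD).
by [].
Qed.

Lemma pushforward_charge (f : X -> Y) (nu : {charge set X -> \bar R}) :
  measurable_fun setT f ->
  exists nu' : {charge set Y -> \bar R}, forall E, nu' E = nu (f @^-1` E).
Proof.
by move=> mf; exists (measure_function_pushforward__canonical__charge_Charge nu mf).
Qed.

End pushforward_measure.

(** * Estimates of integrals *)

Section integral_estimates.
Context d (X : measurableType d) (R : realType) (m : {measure set X -> \bar R}).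
Implicit Types (D E : set X) (f g : X -> R).

Lemma integrable_lincomb (I : Type) (r : seq I) (c : I -> R) (g : I -> X -> R) D :
  measurable D -> (forall i, m.-integrable D (EFin \o g i)) ->
  m.-integrable D (EFin \o (fun x => \sum_(i <- r) c i * g i x)) /\
  \int[m]_(x in D) (\sum_(i <- r) c i * g i x) = \sum_(i <- r) c i * \int[m]_(x in D) (g i x).
Proof.
move=> mD ig; elim: r => [|i r [IHi IHe]].
  under [X in EFin \o X]eq_fun do rewrite big_nil.
  under eq_Rintegral do rewrite big_nil.
  rewrite big_nil; split; first exact: integrable0.
  by rewrite Rintegral_cst// mul0r.
under [X in EFin \o X]eq_fun do rewrite big_cons.
under eq_Rintegral do rewrite big_cons.
have ic : m.-integrable D (EFin \o (fun x => c i * g i x)).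
  exact: (integrableZl mD (c i) (ig i)).
split; first exact: (integrableD mD ic IHi).
by rewrite RintegralD// big_cons IHe RintegralZl.
Qed.

Lemma Rintegral_near_cst (c e : R) D f : measurable D -> m D \is a fin_num ->
  m.-integrable D (EFin \o f) -> (forall x, D x -> `|f x - c| <= e) ->
  `|\int[m]_(x in D) (f x) - c * fine (m D)| <= e * fine (m D).
Proof.
move=> mD fD intf fc.
have icst r : m.-integrable D (EFin \o (cst r)).
  apply/integrableP; split; first by apply/measurable_EFinP; exact: measurable_cst.
  rewrite -[X in (X < _)%E]/(\int[m]_(x in D) (cst `|r|%:E x))%E integral_cst//.
  by apply: lte_mul_pinfty; rewrite ?lee_fin// ltey_eq fD.
rewrite -(Rintegral_cst m mD c) -(Rintegral_cst m mD e) -RintegralB//; last exact: icst.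
have ifc : m.-integrable D (EFin \o (fun x => f x - c)) := integrableB mD intf (icst c).
apply: le_trans (le_normr_Rintegral mD ifc) _.
apply: le_Rintegral => //; last exact: icst.
exact: integrable_norm.
Qed.

Lemma Rintegral_tail (M : R) D E f g : 0 < M -> measurable D -> measurable E ->
  E `<=` D -> m.-integrable D (EFin \o f) -> m.-integrable D (EFin \o g) ->
  (forall x, 0 <= g x) -> (forall x, E x -> `|f x| <= M^-1 * g x) ->
  `|\int[m]_(x in E) (f x)| <= M^-1 * \int[m]_(x in D) (g x).
Proof.
move=> M0 mD mE ED intf intg g0 fg.
have ifE := integrableS mD mE ED intf; have igE := integrableS mD mE ED intg.
apply: le_trans (le_normr_Rintegral mE ifE) _.
apply: (@le_trans _ _ (\int[m]_(x in E) (M^-1 * g x))).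
  apply: le_Rintegral => //; first exact: integrable_norm.
  exact: (integrableZl mE M^-1 igE).
rewrite RintegralZl// ler_wpM2l ?invr_ge0 ?(ltW M0)//.
rewrite -[in leRHS](setDUK ED) Rintegral_setU//.
- by rewrite lerDl Rintegral_ge0.
- exact: measurableD.
- by rewrite setDUK.
- by apply/disj_setPS => x [Ex []].
Qed.

End integral_estimates.

(** * Splitting and translating a representing family *)

Section represented.
Variables (R : realType) (K : numFieldType) (conj : K -> K) (re : K -> R) (emb : R -> K).
Hypothesis rs : real_structure conj re emb.
Variables (H : lmodType K) (ip : H -> H -> K).
Hypothesis ipP : inner_product conj ip.
Variable n : nat.
Local Notation T := 'rV[R]_n.
Local Notation B := (Rn_borel R n).
Local Notation Bh := (Bh re ip).
Local Notation Bpos := (Bpos re ip).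
Local Notation rscale := (rscale_op emb).
Local Notation represents := (represents re emb ip).
Variables (S : set T) (mu : (H -> H) -> {charge set B -> \bar R}) (N : (H -> H) -> mi n -> R).
Hypotheses (clS : closed S) (repr : represents S mu N).

Let mS : measurable (S : set B) := closed_measurable_Rn clS.

(** Trades integrals against a charge for integrals against two measures that have all moments on
    [S]. The relation is additive to stay clear of subtraction of extended reals. *)
Definition splits A (m1 m2 : {measure set B -> \bar R}) :=
  [/\ forall E, measurable E -> m1 E \is a fin_num,
      forall E, measurable E -> m2 E \is a fin_num,
      forall E, measurable E -> (mu A E + m2 E = m1 E)%E,
      (forall al, m1.-integrable S (EFin \o (fun t : B => mono t al)) /\
        m2.-integrable S (EFin \o (fun t : B => mono t al))) &
      forall al, N A al =
        \int[m1]_(t in S) (mono t al) - \int[m2]_(t in S) (mono t al)].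

Lemma represents_splits A : Bh A -> exists m1 m2, splits A m1 m2.
Proof.
have [[muD muZ mupos musupp] ci mom] := repr.
move=> hA; have [c c0 pA] := Bpos_shift rs ipP hA; have pc := Bpos_idZ rs ipP c0.
have E1 := cpos_nonneg (mupos _ pA); have E2 := cpos_nonneg (mupos _ pc).
(* Here [cpos] merely turns charges that are already nonnegative into measures; their values on
   measurable sets are unchanged. *)
pose m1 : {measure set B -> \bar R} := cpos (mu (add_op A (rscale c id))).
pose m2 : {measure set B -> \bar R} := cpos (mu (rscale c id)).
have m1E E : measurable E -> m1 E = mu (add_op A (rscale c id)) E := E1 E.
have m2E E : measurable E -> m2 E = mu (rscale c id) E := E2 E.
have f1 E : measurable E -> m1 E \is a fin_num by move=> mE; rewrite m1E// fin_num_measure.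
have f2 E : measurable E -> m2 E \is a fin_num by move=> mE; rewrite m2E// fin_num_measure.
have muE E : measurable E -> (mu A E + m2 E = m1 E)%E.
  by move=> mE; rewrite m1E// m2E// muD//; exact: pc.1.
have i1 al := (ci _ al pA.1).1; have i2 al := (ci _ al pc.1).1.
exists m1, m2; split => // al; first (split; [exact (i1 al)|exact (i2 al)]).
rewrite -mom//.
have mmono := continuous_measurable_Rn (@continuous_mono R n al).
exact: (cintegral_difference f2 muE mS mmono (i1 al) (i2 al)).2.
Qed.

Lemma continuous_measurable_RnRn (f : T -> T) : continuous f ->
  measurable_fun setT (f : B -> B).
Proof.
move=> cf; apply: (@measurability _ _ B B setT f (@open T : set (set B)) erefl) => _ [U oU <-].
by rewrite setTI; apply: sub_sigma_algebra; move/continuousP : cf; apply.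
Qed.

(** Push-forward along [t |-> t + z]. Expanding translated monomials into monomials gives their
    integrability and the first relation; expanding [t = (t + z) - z] gives the second, which is how
    a representation is carried back to the original moments. *)
Lemma represents_shift (z : T) : exists nu M,
  represents [set t + z | t in S] nu M /\
  forall A, Bh A -> M A =1 shift_moments z (N A) /\ N A =1 shift_moments (- z) (M A).
Proof.
have [[muD muZ mupos musupp] ci mom] := repr.
pose f : B -> B := fun t : T => t + z.
have ctr (u : T) : continuous (fun t : T => t + u).
  by move=> t; apply: continuousD; [exact: cvg_id|exact: cst_continuous].
have mf : measurable_fun setT f by apply: continuous_measurable_RnRn; exact: ctr.
have mfE E : measurable E -> measurable (f @^-1` E).
  by move=> mE; rewrite -[X in measurable X]setTI; exact: mf.
pose S' : set T := [set t + z | t in S].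
have S'E : S' = (fun t => t - z) @^-1` S.
  apply/seteqP; split => [_ [t St <-]|t St]; first by rewrite /= addrK.
  by exists (t - z) => //; rewrite subrK.
have mS' : measurable (S' : set B).
  by apply: closed_measurable_Rn; rewrite S'E; move/continuous_closedP : (ctr (- z)); apply.
have fS' : f @^-1` S' = S.
  by apply/seteqP; split => t; rewrite S'E /= /f addrK.
have [nu nuE] := choice (fun A => pushforward_charge (mu A) mf).
pose mn al (t : B) : R := mono t al.
have mmn al : measurable_fun setT (EFin \o mn al).
  by apply/measurable_EFinP; exact: continuous_measurable_Rn (@continuous_mono R n al).
pose M A al := fine (cintegral (nu A) S' (EFin \o mn al)).
have key A : Bh A -> [/\ forall al, cintegrable (nu A) S' (EFin \o mn al),
    M A =1 shift_moments z (N A) & N A =1 shift_moments (- z) (M A)].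
  move=> /represents_splits[m1 [m2 [f1 f2 mE12 im NE]]].
  have [p1 [p1E ip1]] := pushforward_measure m1 mf.
  have [p2 [p2E ip2]] := pushforward_measure m2 mf.
  have shiftE al : (mn al \o f) = fun t =>
      \sum_(b <- mi_below al) ((mi_binom al b)%:R * mono z (mi_sub al b)) * mn b t.
    by apply/funext => t; rewrite /= /mn /f mono_add.
  have unshiftE al : mn al = fun t =>
      \sum_(b <- mi_below al) ((mi_binom al b)%:R * mono (- z) (mi_sub al b)) * (mn b \o f) t.
    by apply/funext => t; rewrite /mn -[t in LHS](addrK z) mono_add.
  have lin1 al := integrable_lincomb (mi_below al)
    (fun b => (mi_binom al b)%:R * mono z (mi_sub al b)) mS (fun b => (im b).1).
  have lin2 al := integrable_lincomb (mi_below al)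
    (fun b => (mi_binom al b)%:R * mono z (mi_sub al b)) mS (fun b => (im b).2).
  have i1 al : m1.-integrable (f @^-1` S') (EFin \o (mn al \o f)).
    by rewrite fS' shiftE; exact: (lin1 al).1.
  have i2 al : m2.-integrable (f @^-1` S') (EFin \o (mn al \o f)).
    by rewrite fS' shiftE; exact: (lin2 al).1.
  have [j1 e1] : (forall al, p1.-integrable S' (EFin \o mn al)) /\
      forall al, \int[p1]_(t in S') (mn al t) = \int[m1]_(t in S) ((mn al \o f) t).
    by split=> al; have [j e] := ip1 _ _ mS' (mmn al) (i1 al) => //; rewrite /Rintegral e fS'.
  have [j2 e2] : (forall al, p2.-integrable S' (EFin \o mn al)) /\
      forall al, \int[p2]_(t in S') (mn al t) = \int[m2]_(t in S) ((mn al \o f) t).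
    by split=> al; have [j e] := ip2 _ _ mS' (mmn al) (i2 al) => //; rewrite /Rintegral e fS'.
  have pfin E : measurable E -> p2 E \is a fin_num by move=> mE; rewrite p2E f2//; exact: mfE.
  have nup E : measurable E -> (nu A E + p2 E = p1 E)%E.
    by move=> mE; rewrite nuE p1E p2E mE12//; exact: mfE.
  have cd al := cintegral_difference pfin nup mS'
    (continuous_measurable_Rn (@continuous_mono R n al)) (j1 al) (j2 al).
  have ME al : M A al = \int[m1]_(t in S) ((mn al \o f) t) - \int[m2]_(t in S) ((mn al \o f) t).
    by rewrite -e1 -e2; exact: (cd al).2.
  split=> [al|al|al]; first exact: (cd al).1.
    rewrite ME shiftE (lin1 al).2 (lin2 al).2 -sumrB; apply: eq_bigr => b _.
    by rewrite NE mulrBr.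
  rewrite NE -/(mn al) unshiftE.
  rewrite fS' in i1 i2.
  rewrite (integrable_lincomb _ _ mS i1).2 (integrable_lincomb _ _ mS i2).2 -sumrB.
  by apply: eq_bigr => b _; rewrite ME mulrBr.
exists nu, M; split; last by move=> A hA; have [] := key A hA.
split; [split|by move=> A al hA; have [+ _ _] := key A hA; apply|by []].
- by move=> A A' hA hA' E mE; rewrite !nuE muD//; exact: mfE.
- by move=> r A hA E mE; rewrite !nuE muZ//; exact: mfE.
- by move=> A pA E mE; rewrite nuE mupos//; exact: mfE.
- move=> A hA E mE ES; rewrite nuE; apply: musupp => //; first exact: mfE.
  by move=> t /ES /= nS St; apply: nS; exists t.
Qed.

End represented.

(** * Positivity of represented functionals *)

Section positivity.
Variables (R : realType) (K : numFieldType) (conj : K -> K) (re : K -> R) (emb : R -> K).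
Hypothesis rs : real_structure conj re emb.
Variables (H : lmodType K) (ip : H -> H -> K).
Hypothesis ipP : inner_product conj ip.
Variable n : nat.
Local Notation T := 'rV[R]_n.
Local Notation B := (Rn_borel R n).
Local Notation Bh := (Bh re ip).
Local Notation Bpos := (Bpos re ip).
Local Notation rscale := (rscale_op emb).

Lemma map_measure_sum S (mu : (H -> H) -> {charge set B -> \bar R}) (I : Type)
    (r : seq I) (c : I -> R) (F : I -> H -> H) (E : set B) :
  pos_map_measure re emb ip S mu -> (forall i, Bh (F i)) -> measurable E ->
  fine (mu (fun v => \sum_(i <- r) emb (c i) *: F i v) E) =
    \sum_(i <- r) c i * fine (mu (F i) E).
Proof.
move=> [muD muZ _ _] hF mE; elim: r => [|i r IH].
  rewrite (_ : (fun v => _) = rscale 0 (@zero_op _ H)).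
    by rewrite muZ// ?mul0e ?big_nil//; exact: (Bh0 rs ipP).
  by apply/funext => v; rewrite big_nil rscale0.
rewrite (_ : (fun v => _) = add_op (rscale (c i) (F i))
    (fun v => \sum_(i <- r) emb (c i) *: F i v)).
  have hZ := BhZ rs ipP (c i) (hF i).
  have hS := Bh_sum rs ipP r c hF.
  rewrite muD// fineD ?fin_num_measure// IH big_cons muZ// fineM//.
  exact: fin_num_measure.
by apply/funext => v; rewrite big_cons.
Qed.

Lemma ge0_of_small (a b : R) : (forall e, 0 < e -> 0 <= a + e * b) -> 0 <= a.
Proof.
move=> ab; rewrite leNgt; apply/negP => a0.
have b1 : 0 < `|b| + 1 by rewrite ltr_wpDl.
(* For this [e] the term [e * b] is at most [- a / 2], too small to compensate a negative [a]. *)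
have e0 : 0 < - a / (`|b| + 1) / 2 by rewrite !divr_gt0// oppr_gt0.
have := ab _ e0; apply/negP; rewrite -ltNge.
have h : - a / (`|b| + 1) / 2 * b <= - a / (`|b| + 1) / 2 * (`|b| + 1).
  by rewrite ler_wpM2l ?(ltW e0)// (le_trans (ler_norm b))// lerDl.
have e : - a / (`|b| + 1) / 2 * (`|b| + 1) = - a / 2 by field; rewrite gt_eqF.
by rewrite e in h; lra.
Qed.

Lemma represents_positive (S : set T) (mu : (H -> H) -> {charge set B -> \bar R})
    (N : (H -> H) -> mi n -> R) : closed S -> moment_family re emb ip N ->
  represents re emb ip S mu N -> moment_positive re emb ip S N.
Proof.
move=> clS NP repr p hp p0.
have mS : measurable (S : set B) := closed_measurable_Rn clS.
have [s us sp] := supp_seq hp.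
rewrite (moment_sumE rs ipP NP us sp).
have [m1 hm1] := choice (fun a => represents_splits rs ipP clS repr (hp.2 a)).
have [m2 sm] := choice hm1.
(* [sigma E] is the integral of [p] over [E]; [tau E] is the total mass of the splitting measures
   and controls the error of freezing the monomials at a point. *)
pose sigma (E : set B) : R := \sum_(a <- s)
  (\int[m1 a]_(t in E) (mono t a) - \int[m2 a]_(t in E) (mono t a)).
pose tau (E : set B) : R := \sum_(a <- s) (fine (m1 a E) + fine (m2 a E)).
have -> : \sum_(a <- s) N (p a) a = sigma S.
  by apply: eq_bigr => a _; have [_ _ _ _] := sm a; apply.
have f1 a E : measurable E -> m1 a E \is a fin_num by have [+ _ _ _ _] := sm a; apply.
have f2 a E : measurable E -> m2 a E \is a fin_num by have [_ + _ _ _] := sm a; apply.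
have i1 a b : (m1 a).-integrable S (EFin \o (fun t : B => mono t b)).
  by have [_ _ _ + _] := sm a => /(_ b)[].
have i2 a b : (m2 a).-integrable S (EFin \o (fun t : B => mono t b)).
  by have [_ _ _ + _] := sm a => /(_ b)[].
have iE (m : {measure set B -> \bar R}) (E : set B) b :
    m.-integrable S (EFin \o (fun t : B => mono t b)) -> measurable E -> E `<=` S ->
    m.-integrable E (EFin \o (fun t : B => mono t b)).
  by move=> im mE ES; exact: integrableS im.
have sigmaU (E F : set B) : measurable E -> measurable F -> E `<=` S -> F `<=` S ->
    E `&` F = set0 -> sigma (E `|` F) = sigma E + sigma F.
  move=> mE mF ES FS EF; rewrite /sigma -big_split; apply: eq_bigr => a _ /=.
  have mEF := measurableU _ _ mE mF.
  have EFS : E `|` F `<=` S by rewrite subUset.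
  have dEF : [disjoint E & F] by apply/eqP.
  rewrite (Rintegral_setU mE mF (iE _ _ _ (i1 a a) mEF EFS) dEF).
  by rewrite (Rintegral_setU mE mF (iE _ _ _ (i2 a a) mEF EFS) dEF) opprD addrACA.
have tauU (E F : set B) : measurable E -> measurable F -> E `&` F = set0 ->
    tau (E `|` F) = tau E + tau F.
  move=> mE mF EF; rewrite /tau -big_split; apply: eq_bigr => a _ /=.
  by rewrite !measureU// !fineD ?f1 ?f2// addrACA.
have local (e : R) (u : T) (E : set B) : S u -> measurable E -> E `<=` S ->
    (forall t a, E t -> a \in s -> `|mono t a - mono u a| <= e) ->
    0 <= sigma E + e * tau E.
  move=> Su mE ES near_u.
  (* Positivity of [p] enters here: [peval emb p u] is a fixed positive operator, and expanding its
     measure over the coefficients gives the integral of [p] with every monomial frozen at [u]. *)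
  have pu : (0 <= mu (peval emb p u) E)%E.
    by have [[_ _ + _] _ _] := repr; apply=> //; exact: p0.
  have pE : peval emb p u = fun v => \sum_(a <- s) emb (mono u a) *: p a v.
    by apply/funext => v; exact: pevalE.
  have {}pu : 0 <= \sum_(a <- s) mono u a * (fine (m1 a E) - fine (m2 a E)).
    have [rep _ _] := repr.
    have := fine_ge0 pu; rewrite pE (map_measure_sum _ _ rep hp.2 mE).
    congr (_ <= _); apply: eq_bigr => a _; congr (_ * _).
    have [_ _ /(_ _ mE) <- _ _] := sm a.
    by rewrite fineD ?fin_num_measure ?f2// addrK.
  apply: (le_trans pu); rewrite /sigma /tau mulr_sumr -big_split [leLHS]big_seq [leRHS]big_seq.
  apply: ler_sum => a a_s /=.
  have := Rintegral_near_cst mE (f1 a E mE) (iE _ _ _ (i1 a a) mE ES)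
    (fun t Et => near_u t a Et a_s).
  have := Rintegral_near_cst mE (f2 a E mE) (iE _ _ _ (i2 a a) mE ES)
    (fun t Et => near_u t a Et a_s).
  by rewrite !ler_norml => /andP[? ?] /andP[? ?]; lra.
have sigma0 : sigma set0 = 0.
  by rewrite /sigma big1// => a _; rewrite !Rintegral_set0 subrr.
have tau0 : tau set0 = 0 by rewrite /tau big1// => a _; rewrite !measure0/= addr0.
pose nearby (e : R) (u : T) : set T := [set t | \sum_(a <- s) `|mono t a - mono u a| < e].
have open_nearby e u : open (nearby e u).
  have cf : continuous (fun t : T => \sum_(a <- s) `|mono t a - mono u a|).
    apply: continuous_sumR => a; pose f (t : T) : R := mono t a - mono u a.
    have cf : continuous f.
      move=> t; apply: (@continuousB _ R^o); last exact: cst_continuous.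
      exact: continuous_mono.
    by move=> t; apply: (@continuous_comp _ _ _ f); [exact: cf|exact: norm_continuous].
  have -> : nearby e u = (fun t : T => \sum_(a <- s) `|mono t a - mono u a|) @^-1` `]-oo, e[.
    by apply/seteqP; split => t; rewrite /nearby /= in_itv.
  by move/continuousP : cf; apply; exact: interval_open.
(* Neighbourhoods are cut out of [E] one after the other, so the pieces are disjoint and the errors
   add up to [e * tau E], however many neighbourhoods there are. *)
have cover e (r : seq T) (E : set B) : (forall u, u \in r -> S u) -> measurable E -> E `<=` S ->
    (forall t, E t -> exists2 u, u \in r & nearby e u t) -> 0 <= sigma E + e * tau E.
  elim: r E => [|u r IH] E rS mE ES Er.
    have -> : E = set0 by apply/seteqP; split => // t /Er[].
    by rewrite sigma0 tau0 mulr0 addr0.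
  have mU : measurable (nearby e u : set B) := open_measurable_Rn (open_nearby e u).
  have mEU := measurableI _ _ mE mU; have mED := measurableD mE mU.
  have EUS : E `&` nearby e u `<=` S by move=> t [/ES].
  have EDS : E `\` nearby e u `<=` S by move=> t [/ES].
  have dis : (E `&` nearby e u) `&` (E `\` nearby e u) = set0.
    by apply/seteqP; split => // t [[_ ?] [_]].
  have EE : E = (E `&` nearby e u) `|` (E `\` nearby e u) by rewrite setUIDK.
  rewrite EE sigmaU// tauU//.
  have h1 : 0 <= sigma (E `&` nearby e u) + e * tau (E `&` nearby e u).
    apply: (local _ u) => //; first by apply: rS; rewrite inE eqxx.
    move=> t a [_ /ltW ut] a_s; apply: le_trans ut.
    rewrite (bigD1_seq a)//= lerDl; exact: sumr_ge0.
  have h2 : 0 <= sigma (E `\` nearby e u) + e * tau (E `\` nearby e u).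
    apply: IH => //; first by move=> v vr; apply: rS; rewrite inE vr orbT.
    move=> t [/Er[v + vt] nt]; rewrite inE => /orP[/eqP vu|vr]; last by exists v.
    by exfalso; apply: nt; rewrite -vu.
  by move: h1 h2; rewrite mulrDr; lra.
pose C (M : R) : set T := S `&` [set t | weight t <= M].
have mW (M : R) : measurable ([set t | weight t <= M] : set B).
  apply: closed_measurable_Rn; apply: compact_closed; first exact: norm_hausdorff.
  exact: weight_le_compact.
have mC M : measurable (C M : set B) by apply: measurableI.
have CS M : C M `<=` S by move=> t [].
have sigmaC M : 0 <= sigma (C M).
  apply: (@ge0_of_small _ (tau (C M))) => e e0.
  have cC : compact (C M).
    rewrite /C setIC; apply: compact_closedI => //; exact: weight_le_compact.
  have CC : C M `<=` \bigcup_(u in C M) nearby e u.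
    by move=> t Ct; exists t => //; rewrite /nearby /= big1// => a _; rewrite subrr normr0.
  have := cC; rewrite compact_cover => /(_ _ (C M) (nearby e) (fun u _ => open_nearby e u) CC).
  move=> [D' D'C CD'].
  apply: (cover e (finmap.enum_fset D')) => // u /D'C.
  by rewrite inE => -[].
(* On [S] outside [C M] one has [|t^a| <= |t^a| weight t / M]. *)
pose g a (t : B) := mono t a * weight t.
have ig (m : {measure set B -> \bar R}) a :
    (forall b, m.-integrable S (EFin \o (fun t : B => mono t b))) ->
    m.-integrable S (EFin \o g a).
  move=> im; pose e i : mi n := [tuple (if j == i then 2 else 0)%N | j < n].
  (* Multiplying by the weight gives a sum of monomials again, with exponents [a] and [a + 2 e_i],
     so integrability of all moments suffices. *)
  have gE : g a = fun t => mono t a + \sum_(i <- index_enum 'I_n) 1 * mono t (mi_add a (e i)).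
    apply/funext => t; rewrite /g /weight mulrDr mulr1 mulr_sumr; congr (_ + _).
    apply: eq_bigr => i _; rewrite mul1r monoD; congr (_ * _).
    rewrite /mono (bigD1 i)//= big1 ?mulr1; first by rewrite tnth_mktuple eqxx.
    by move=> j ji; rewrite tnth_mktuple (negbTE ji) expr0.
  have [isum _] := integrable_lincomb (index_enum 'I_n) (fun=> 1) mS (fun i => im (mi_add a (e i))).
  by rewrite gE; exact: (integrableD mS (im a) isum).
pose bnd := \sum_(a <- s) (\int[m1 a]_(t in S) `|g a t| + \int[m2 a]_(t in S) `|g a t|).
have tail M : 0 < M -> 0 <= sigma S + M^-1 * bnd.
  move=> M0; have mSC := measurableD mS (mC M).
  have SCS : S `\` C M `<=` S by move=> t [].
  have dis : C M `&` (S `\` C M) = set0 by apply/seteqP; split => // t [? []].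
  rewrite -(setDUK (CS M)) sigmaU// -addrA addr_ge0// /sigma /bnd mulr_sumr -big_split.
  apply: sumr_ge0 => a _ /=.
  have bound (t : B) : (S `\` C M) t -> `|mono t a| <= M^-1 * `|g a t|.
    move=> [St nC]; rewrite /g normrM mulrCA -[leLHS]mulr1 ler_wpM2l//.
    rewrite mulrC ler_pdivlMr// mul1r gtr0_norm ?weight_gt0//.
    by rewrite leNgt; apply/negP => /ltW tM; apply: nC.
  have ng (t : B) : 0 <= `|g a t| by [].
  have t1 := Rintegral_tail M0 mS mSC SCS (i1 a a) (integrable_norm (ig _ a (i1 a))) ng bound.
  have t2 := Rintegral_tail M0 mS mSC SCS (i2 a a) (integrable_norm (ig _ a (i2 a))) ng bound.
  move: t1 t2; rewrite !ler_norml /= => /andP[? ?] /andP[? ?]; lra.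
apply: (@ge0_of_small _ bnd) => e e0.
by have := tail e^-1; rewrite invr_gt0 invrK; apply.
Qed.

End positivity.

(** * The equivalence *)

Section equivalence.
Variables (R : realType) (K : numFieldType) (conj : K -> K) (re : K -> R) (emb : R -> K).
Hypothesis rs : real_structure conj re emb.
Variables (H : lmodType K) (ip : H -> H -> K).
Hypothesis ipP : inner_product conj ip.
Variable n : nat.
Variables (S : set 'rV[R]_n) (T : opoly_fun H n -> opoly_fun H n).
Hypotheses (clS : closed S) (linT : op_linear re emb ip T).
Local Notation Bh := (Bh re ip).
Local Notation opoly := (opoly re ip).
Local Notation qf := (qf re ip).
Local Notation peval := (peval emb).

Let moments (y : 'rV[R]_n) (v : H) (A : H -> H) (al : mi n) : R :=
  qf (peval (T (mon A al)) y) v.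

Let TP p : opoly p -> opoly (T p). Proof. by have [+ _ _] := linT; apply. Qed.

Lemma opoly_sum (I : Type) (r : seq I) (c : I -> R) (P : I -> opoly_fun H n) :
  (forall i, opoly (P i)) ->
  opoly (fun g v => \sum_(i <- r) emb (c i) *: P i g v) /\
  forall y v, qf (peval (fun g v => \sum_(i <- r) emb (c i) *: P i g v) y) v =
    \sum_(i <- r) c i * qf (peval (P i) y) v.
Proof.
move=> hP; elim: r => [|i r [IHp IHq]].
  have s0 : supp (fun (g : mi n) (v : H) => \sum_(i <- [::]) emb (c i) *: P i g v) `<=` [set` [::]].
    by move=> g /= nz; exfalso; apply: nz; apply/funext => v; rewrite big_nil.
  split=> [|y v]; last by rewrite (qf_peval rs ipP _ _ _ s0)// !big_nil.
  split=> [|g]; first exact: sub_finite_set s0 _.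
  rewrite (_ : (fun v => _) = @zero_op _ H); first exact: (Bh0 rs ipP).
  by apply/funext => v; rewrite big_nil.
have hc := opolyZ rs ipP (c i) (hP i).
rewrite (_ : (fun g v => _) = padd (pscale emb (c i) (P i))
    (fun g v => \sum_(i <- r) emb (c i) *: P i g v)); last first.
  by apply/funext => g; apply/funext => v; rewrite big_cons.
split=> [|y v]; first exact: (opolyD rs ipP).
by rewrite (qf_pevalD rs ipP)// (qf_pevalZ rs ipP)// IHq big_cons.
Qed.

Lemma mon_decomposition p s : uniq s -> supp p `<=` [set` s] -> (forall a, Bh (p a)) ->
  forall y v, qf (peval (T p) y) v = \sum_(a <- s) moments y v (p a) a.
Proof.
have [_ TD TZ] := linT.
elim: s p => [|b s IH] p us sp hp y v.
  (* The zero polynomial is written as 0 times a monomial, so that homogeneity of [T] takes care of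
     its image. *)
  have -> : p = pscale emb 0 (mon (@zero_op _ H) [tuple 0%N | i < n]).
    apply/funext => a; apply/funext => x.
    have -> : p a = @zero_op _ H by apply: contrapT => /sp.
    by rewrite /pscale /rscale_op (emb0 rs) scale0r.
  have h0 := opoly_mon rs ipP [tuple 0%N | i < n] (Bh0 rs ipP).
  by rewrite TZ// (qf_pevalZ rs ipP) ?mul0r ?big_nil//; exact: TP.
pose q : opoly_fun H n := fun a => if a == b then @zero_op _ H else p a.
have sq : supp q `<=` [set` s].
  move=> a; rewrite /supp /q /=; case: eqP => // ab /sp /=.
  by rewrite inE => /orP[/eqP|].
have hq a : Bh (q a) by rewrite /q; case: ifP => _ //; exact: (Bh0 rs ipP).
have oq : opoly q by split => //; exact: sub_finite_set sq _.
have ob := opoly_mon rs ipP b (hp b).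
have -> : p = padd (mon (p b) b) q.
  apply/funext => a; apply/funext => x; rewrite /padd /mon /q /add_op.
  by case: eqP => [->|_]; rewrite /zero_op ?addr0 ?add0r.
rewrite TD// (qf_pevalD rs ipP); [|exact: TP..].
move: us; rewrite /= => /andP[bs us].
rewrite (IH q us sq hq) big_cons; congr (_ + _).
  by rewrite /moments /padd /mon /q eqxx; congr (qf (peval (T _) y) v); apply/funext => a;
    apply/funext => x; case: ifP => // _; rewrite /add_op /zero_op addr0.
rewrite big_seq [RHS]big_seq; apply: eq_bigr => a a_s.
have ab : a != b by apply: contraNneq bs => <-.
congr (moments _ _ _ _); apply/funext => x.
by rewrite /padd /mon /q (negbTE ab) /add_op /zero_op add0r.
Qed.

Let moments_family y v : moment_family re emb ip (moments y v).
Proof.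
have [_ TD TZ] := linT; split=> [A B al hA hB|r A al hA].
  have oA := opoly_mon rs ipP al hA; have oB := opoly_mon rs ipP al hB.
  have -> : moments y v (add_op A B) al = qf (peval (T (padd (mon A al) (mon B al))) y) v.
    congr (qf (peval (T _) y) v); apply/funext => a; apply/funext => x.
    by rewrite /padd /mon /add_op; case: ifP => // _; rewrite /zero_op addr0.
  by rewrite TD// (qf_pevalD rs ipP)//; exact: TP.
have oA := opoly_mon rs ipP al hA.
have -> : moments y v (rscale_op emb r A) al = qf (peval (T (pscale emb r (mon A al))) y) v.
  congr (qf (peval (T _) y) v); apply/funext => a; apply/funext => x.
  by rewrite /pscale /mon /rscale_op; case: ifP => // _; rewrite /zero_op scaler0.
by rewrite TZ// (qf_pevalZ rs ipP)//; exact: TP.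
Qed.

Let moment_sumT y v p : opoly p -> qf (peval (T p) y) v = moment_sum (moments y v) p.
Proof.
move=> hp; have [s us sp] := supp_seq hp.
by rewrite (mon_decomposition us sp hp.2) (moment_sumE rs ipP (moments_family y v) us sp).
Qed.

(** The sign [(-1)^(al - b)] and the factor [y^(al - b)] combine to the monomial of [- y]: the
    canonical coefficients are the moments of [T] at [y], translated by [- y]. *)
Let Qcan_moments y v A al : Bh A ->
  qf (peval (Qcan emb T al A) y) v = shift_moments (- y) (moments y v A) al.
Proof.
move=> hA; have oT b := TP (opoly_mon rs ipP b hA).
have -> : Qcan emb T al A = fun g v => \sum_(b <- mi_below al)
    emb ((-1) ^+ mi_abs (mi_sub al b) * (mi_binom al b)%:R) *:
      pmulX (T (mon A b)) (mi_sub al b) g v.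
  apply/funext => g; apply/funext => x; rewrite /Qcan -mi_belowE.
  by rewrite -fsbig_seq// mi_below_uniq.
have [_ ->] := opoly_sum (mi_below al)
  (fun b => (-1) ^+ mi_abs (mi_sub al b) * (mi_binom al b)%:R)
  (fun b => opoly_pmulX rs ipP (mi_sub al b) (oT b)).
apply: eq_bigr => b _; rewrite /moments {1}/qf.
rewrite (@peval_pmulX _ _ _ _ _ rs H ip n _ _ _ _ (oT b)) (ipZl ipP) (reM rs).
by rewrite mono_opp /qf; ring.
Qed.

Lemma represents_cond_ii : cond_ii re emb ip S T <->
  forall y, S y -> forall v, exists mu, represents re emb ip S mu (moments y v).
Proof.
split=> h y Sy v; have [mu] := h y Sy v.
  move=> [mP ci mom]; exists mu; split=> // A al hA.
  have mS : measurable (S : set (Rn_borel R n)) := closed_measurable_Rn clS.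
  have hz := Bh0 rs ipP.
  have mu0 (E : set (Rn_borel R n)) : measurable E -> mu (@zero_op _ H) E = 0%E.
    by move=> mE; have [_ muZ _ _] := mP; rewrite -(rscale0 emb H 0) muZ// mul0e.
  (* The monomial with coefficient 0 has empty support, so the hypothesis gives an empty sum there;
     that the integral against its charge vanishes is shown by writing this charge as [m - m]. *)
  have N0 a : fine (cintegral (mu (@zero_op _ H)) S (fun t : Rn_borel R n => (mono t a)%:E)) = 0.
    pose m : {measure set (Rn_borel R n) -> \bar R} := cpos (mu (@zero_op _ H)).
    have fm (E : set (Rn_borel R n)) : measurable E -> m E \is a fin_num by exact: fin_num_measure.
    have mE (E : set (Rn_borel R n)) : measurable E -> (mu (@zero_op _ H) E + m E = m E)%E.
      by move=> mE'; rewrite mu0// add0e.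
    have im := (ci _ a hz).1.
    have [_] := cintegral_difference fm mE mS
      (continuous_measurable_Rn (@continuous_mono R n a)) im im.
    by rewrite subrr.
  have := mom _ (opoly_mon rs ipP al hA); rewrite -[LHS]/(moments y v A al) => ->.
  rewrite (@sum_suppE K H n R (fun a A => fine (cintegral (mu A) S
    (fun t : Rn_borel R n => (mono t a)%:E))) (mon A al) [:: al] N0 _ (@supp_mon _ H n A al))//.
  by rewrite big_seq1 /mon eqxx.
move=> [mP ci mom]; exists mu; split=> // p hp.
rewrite -[LHS]/(qf (peval (T p) y) v) moment_sumT//.
by apply: eq_fsbigr => a _; rewrite mom//; exact: hp.2.
Qed.

Lemma cond_i_ii : cond_i re emb ip S T -> cond_ii re emb ip S T.
Proof.
move=> h; apply/represents_cond_ii => y Sy v.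
apply: (haviland rs ipP clS (moments_family y v)) => p hp /(h p hp)/(_ y Sy).
by move/(BposE rs ipP (Bh_peval rs ipP y (TP hp))) => /(_ v); rewrite moment_sumT.
Qed.

Lemma cond_ii_iii : cond_ii re emb ip S T -> cond_iii re emb ip S T.
Proof.
move=> /represents_cond_ii h y Sy v; have [mu repr] := h y Sy v.
have [nu [M [[nuP ci mom] MN]]] := represents_shift rs ipP clS repr (- y).
exists nu; split=> // al A hA.
by rewrite mom// (MN A hA).1 -Qcan_moments.
Qed.

Lemma closed_translate (y : 'rV[R]_n) : closed [set k - y | k in S].
Proof.
rewrite (_ : [set _ | _ in _] = (fun t => t + y) @^-1` S).
  have ctr : continuous (fun t : 'rV[R]_n => t + y).
    by move=> t; apply: continuousD; [exact: cvg_id|exact: cst_continuous].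
  by move/continuous_closedP : ctr; apply.
apply/seteqP; split => [_ [t St <-]|t St]; first by rewrite /= subrK.
by exists (t + y) => //; rewrite addrK.
Qed.

Lemma cond_iii_i : cond_iii re emb ip S T -> cond_i re emb ip S T.
Proof.
move=> h p hp p0 y Sy; have hTp := Bh_peval rs ipP y (TP hp).
apply/(BposE rs ipP hTp) => v; rewrite moment_sumT//.
have [nu [nuP ci mom]] := h y Sy v.
have repr : represents re emb ip [set k - y | k in S] nu
    (fun A al => qf (peval (Qcan emb T al A) y) v).
  by split=> // A al hA; rewrite -mom.
have [mu [M [[muP ci' mom'] MN]]] := represents_shift rs ipP (@closed_translate y) repr y.
have SE : [set t + y | t in [set k - y | k in S]] = S.
  apply/seteqP; split => [_ [_ [t St <-] <-]|t St]; first by rewrite subrK.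
  by exists (t - y); [exists t|rewrite subrK].
rewrite SE in muP ci' mom'.
apply: (represents_positive rs ipP clS (moments_family y v) (mu := mu)) => //.
split=> // A al hA; rewrite mom'//.
(* The translated-back moments [M] and the moments of [T] have the same translate by [- y], namely
   the canonical coefficients, so injectivity identifies them. *)
apply: (@shift_moments_inj R n (- y)) => b.
by rewrite -Qcan_moments// -(MN A hA).2.
Qed.

End equivalence.

(** * The real and the complex scalar field *)

Section scalar_fields.
Variable R : realType.

Lemma real_structure_real : real_structure (fun z : R => z) (fun z : R => z) (fun z : R => z).
Proof. by split. Qed.

Lemma real_structure_complex :
  real_structure (fun z : R[i] => z^*) (@complex.Re R) (fun r : R => (r%:C)%C).
Proof.
split.
- by move=> a b; rewrite rmorphD.
- by move=> a b; rewrite rmorphM.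
- by move=> z w; rewrite rmorphM.
- by move=> z w; rewrite rmorphD.
- by move=> a; rewrite -[LHS]/(conjc a%:C%C) /conjc /= oppr0.
- by move=> [a b] [c d].
- by move=> a [b c]; rewrite /= mul0r subr0.
- by move=> [a b].
- by move=> a; rewrite lecR.
- move=> [a b] /eqP; rewrite eq_complex /= => /andP[_ /eqP h].
  by rewrite /real_complex_def/=; congr (_ +i* _)%C; lra.
Qed.

End scalar_fields.

Theorem theorem3p1 (R : realType) (n : nat) :
  (* real Hilbert spaces: K = R, conj = id, re = id, embedding R -> K = id *)
  (forall (H : lmodType R) (ip : H -> H -> R) (Kset : set 'rV[R]_n)
          (T : opoly_fun H n -> opoly_fun H n),
     hilbert (fun z : R => z) (fun z : R => z) ip ->
     closed Kset ->
     op_linear (fun z : R => z) (fun z : R => z) ip T ->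
     [<-> cond_i (fun z : R => z) (fun z : R => z) ip Kset T;
          cond_ii (fun z : R => z) (fun z : R => z) ip Kset T;
          cond_iii (fun z : R => z) (fun z : R => z) ip Kset T]) /\
  (* complex Hilbert spaces: K = R[i], conj = complex conjugation, re = Re *)
  (forall (H : lmodType R[i]) (ip : H -> H -> R[i]) (Kset : set 'rV[R]_n)
          (T : opoly_fun H n -> opoly_fun H n),
     hilbert (fun z : R[i] => z^*) (@complex.Re R) ip ->
     closed Kset ->
     op_linear (@complex.Re R) (fun r : R => (r%:C)%C) ip T ->
     [<-> cond_i (@complex.Re R) (fun r : R => (r%:C)%C) ip Kset T;
          cond_ii (@complex.Re R) (fun r : R => (r%:C)%C) ip Kset T;
          cond_iii (@complex.Re R) (fun r : R => (r%:C)%C) ip Kset T]).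
Proof.
split=> H ip Kset T [ipP _] clK linT.
  have rs := real_structure_real R; tfae.
  - exact: (cond_i_ii rs ipP clK linT).
  - exact: (cond_ii_iii rs ipP clK linT).
  - exact: (cond_iii_i rs ipP clK linT).
have rs := real_structure_complex R; tfae.
- exact: (cond_i_ii rs ipP clK linT).
- exact: (cond_ii_iii rs ipP clK linT).
- exact: (cond_iii_i rs ipP clK linT).
Qed.
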